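(* Let $1<r<+\infty$, $r\ne2$, $1/r+1/r'=1$, $\eta_0>0$, $\lambda>0$, $f'\in L^\infty(\omega)^2$, and let $(\widetilde u,\widetilde p)\in V^r_{y_3}(\Omega)^3\times(L^{r'}_0(\omega)\cap W^{1,r'}(\omega))$, $\widetilde u=(\widetilde u',\widetilde u_3)$ with $\widetilde u_3\equiv0$, be the solution of the reduced Carreau Stokes system $$\left\{\begin{array}{rl} -\partial_{y_3}\Big(\big(1+\frac{\lambda}{2}|\partial_{y_3}\widetilde u'|^2\big)^{\frac r2-1}\partial_{y_3}\widetilde u'\Big)=\frac{2}{\eta_0}\big(f'(y')-\nabla_{y'}\widetilde p(y')\big)&\text{in }\Omega,\\[4pt] {\rm div}_{y'}\Big(\int_0^{h(y')}\widetilde u'\,dy_3\Big)=0&\text{in }\omega,\\[4pt] \Big(\int_0^{h(y')}\widetilde u'\,dy_3\Big)\cdot n=0&\text{on }\partial\omega,\\[4pt] \widetilde u'=0&\text{on }\Gamma_0\cup\Gamma_1. \end{array}\right.$$ Then the Reynolds velocity $\widetilde V(y')=\int_0^{h(y')}\widetilde u(y',y_3)\,dy_3$, $\widetilde V=(\widetilde V',\widetilde V_3)$, is given by $$\widetilde V'(y')=2\left(f'(y')-\nabla_{y'}\widetilde p(y')\right)\int_{-\frac{h(y')}{2}}^{\frac{h(y')}{2}}\frac{\big(\frac{h(y')}{2}+\xi\big)\xi}{\psi\big(2|f'(y')-\nabla_{y'}\widetilde p(y')||\xi|\big)}\,d\xi,\qquad \widetilde V_3(y')=0,\qquad\text{in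 }\omega,$$ and the limit law for the pressure can be written as $$\left\{\begin{array}{l} {\rm div}_{y'}\left(\left(\displaystyle\int_{-\frac{h(y')}{2}}^{\frac{h(y')}{2}}\frac{\big(\frac{h(y')}{2}+\xi\big)\xi}{\psi\big(2|f'(y')-\nabla_{y'}\widetilde p(y')||\xi|\big)}\,d\xi\right)\left(f'(y')-\nabla_{y'}\widetilde p(y')\right)\right)=0\quad\text{in }\omega,\\[10pt] \left(\left(\displaystyle\int_{-\frac{h(y')}{2}}^{\frac{h(y')}{2}}\frac{\big(\frac{h(y')}{2}+\xi\big)\xi}{\psi\big(2|f'(y')-\nabla_{y'}\widetilde p(y')||\xi|\big)}\,d\xi\right)\left(f'(y')-\nabla_{y'}\widetilde p(y')\right)\right)\cdot n=0\quad\text{on }\partial\omega. \end{array}\right.$$ Here, for $\tau\geq 0$, $\zeta=\psi(\tau)>0$ is the unique solution of $$\tau=\zeta\sqrt{\frac2\lambda\left\{\left(\frac{\zeta}{\eta_0}\right)^{\frac{2}{r-2}}-1\right\}}.$$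
   Context: Geometry: $\omega\subset\mathbb{R}^2$ is a smooth and connected (open) subset; $h$ is a positive $C^1$ function defined on $\omega$ with $0<h_{\min}\le h(y')\le h_{\max}<+\infty$. Points are $y=(y',y_3)\in\mathbb{R}^2\times\mathbb{R}$; $\Omega=\{(y',y_3): y'\in\omega,\ 0<y_3<h(y')\}$, $\Gamma_0=\omega\times\{0\}$, $\Gamma_1=\{(y',y_3): y'\in\omega,\ y_3=h(y')\}$. The vector $n$ is the outward unit normal to $\partial\omega$. $L^{r'}_0$ denotes the space of functions of $L^{r'}$ with zero mean value. $V^r_{y_3}(\Omega)=\{\varphi\in L^r(\Omega):\partial_{y_3}\varphi\in L^r(\Omega)\}$, a Banach space with norm $(\|\varphi\|_{L^r(\Omega)}^r+\|\partial_{y_3}\varphi\|_{L^r(\Omega)}^r)^{1/r}$. Equations are understood in the weak sense; $|\cdot|$ is the Euclidean norm. The pair $(\widetilde u,\widetilde p)$ is the limit as $\varepsilon\to0$ of $(\varepsilon^{-1}\widetilde u_\varepsilon,\widetilde p_\varepsilon)$, where $(\widetilde u_\varepsilon,\widetilde p_\varepsilon)$ is the rescaled velocity/pressure of a Carreau Stokes flow (zero high-rate viscosity) in the thin domain $\{x'\in\omega,\ 0<x_3<\varepsilon h(x')\}$. *)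

(* Defs.v *)
From HB Require Import structures.
From mathcomp Require Import all_boot all_order all_algebra.
From mathcomp Require Import all_classical all_reals all_analysis.

Set Implicit Arguments.
Unset Strict Implicit.
Unset Printing Implicit Defensive.

Import Order.TTheory GRing.Theory Num.Theory.
Import numFieldNormedType.Exports.

Local Open Scope classical_set_scope.
Local Open Scope ring_scope.

(* A point of the plane is y' : R * R and a point of space is
   y = (y', y3) : (R * R) * R; a vector of R^3 is split in the same way.
   The library norm on these products is the sup norm, hence [enorm]. *)

(* Lebesgue measure on the plane and on space, with sigma-finiteness (not
   inferred for \x by the library) so that Fubini applies to [leb3]. *)
Definition leb2 {R : realType} :
    set (measurableTypeR R * measurableTypeR R)%type -> \bar R :=
  (@lebesgue_measure R \x @lebesgue_measure R)%E.
HB.instance Definition _ (R : realType) := Measure.on (@leb2 R).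

Lemma leb2_sigma_finite (R : realType) : sigma_finite setT (@leb2 R).
Proof.
have /sigma_finiteP[F [TF ndF Foo]] := sigma_finiteT (@lebesgue_measure R).
exists (fun n => F n `*` F n).
  rewrite -setXTT TF predeqE => -[x y]; split.
    move=> [/= [n _ Fnx] [k _ Fky]]; exists (maxn n k) => //; split.
    - by move: x Fnx; exact/subsetPset/ndF/leq_maxl.
    - by move: y Fky; exact/subsetPset/ndF/leq_maxr.
  by move=> [n _ []/= ? ?]; split; exists n.
move=> k; have [? ?] := Foo k; split; first exact: measurableX.
by rewrite /leb2 product_measure1E// lte_mul_pinfty// ge0_fin_numE.
Qed.
HB.instance Definition _ (R : realType) :=
  Measure_isSigmaFinite.Build _ _ _ (@leb2 R) (@leb2_sigma_finite R).

Definition leb3 {R : realType} :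
    set (measurableTypeR R * measurableTypeR R * measurableTypeR R)%type -> \bar R :=
  (@leb2 R \x @lebesgue_measure R)%E.
HB.instance Definition _ (R : realType) := Measure.on (@leb3 R).

Section Carreau.
Context {R : realType}.

Definition dot (a b : R * R) : R := a.1 * b.1 + a.2 * b.2.
Definition enorm (a : R * R) : R := Num.sqrt (dot a a).

Definition e3 : R * R * R := ((0, 0), 1).
Definition grad (theta : R * R -> R) (x : R * R) : R * R :=
  ('D_(1, 0) theta x, 'D_(0, 1) theta x).

(* C^k on the open set A.  In finite dimension it is enough that all the
   directional derivatives exist and are C^(k-1). *)
Fixpoint Ck_on {V : normedModType R} (A : set V) (k : nat) (g : V -> R) : Prop :=
  (forall x, A x -> {for x, continuous g}) /\
  match k with
  | 0%N => True
  | k'.+1 => forall v : V,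
      (forall x, A x -> derivable g x v) /\ Ck_on A k' (fun x => 'D_v g x)
  end.

Definition smooth_on {V : normedModType R} (A : set V) (g : V -> R) : Prop :=
  forall k, Ck_on A k g.

Definition test_fun {V : normedModType R} (A : set V) (g : V -> R) : Prop :=
  [/\ smooth_on setT g, compact (closure [set x | g x != 0])
    & closure [set x | g x != 0] `<=` A].

(* Near each boundary point, A is the sublevel set {rho < 0} of a smooth
   function with nonvanishing gradient; the outward unit normal is then
   grad rho / |grad rho|. *)
Definition smooth_boundary (A : set (R * R)) : Prop :=
  forall x, closure A x -> ~ interior A x ->
  exists (U : set (R * R)) (rho : R * R -> R),
    [/\ open U, U x, smooth_on U rho, grad rho x != 0
      & forall y, U y -> (A y <-> rho y < 0)].

Definition Lp_on {d} {T : measurableType d} (mu : {measure set T -> \bar R})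
    (A : set T) (q : \bar R) (g : T -> R) : Prop := (g \_ A) \in Lfun mu q.

(* [G] is the distributional gradient of [g] in the open set [A]. *)
Definition weak_grad (A : set (R * R)) (g : R * R -> R) (G : R * R -> R * R) :=
  forall theta, test_fun A theta ->
    \int[leb2]_(x in A) (g x * (grad theta x).1)
      = - (\int[leb2]_(x in A) ((G x).1 * theta x)) /\
    \int[leb2]_(x in A) (g x * (grad theta x).2)
      = - (\int[leb2]_(x in A) ((G x).2 * theta x)).

(* [d] is the distributional divergence of [F] in the open set [A]. *)
Definition weak_div (A : set (R * R)) (F : R * R -> R * R) (d : R * R -> R) :=
  forall theta, test_fun A theta ->
    \int[leb2]_(x in A) dot (F x) (grad theta x)
      = - (\int[leb2]_(x in A) (d x * theta x)).

(* F . n = 0 on the boundary of [A], where [d] is the divergence of [F]: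
   the normal trace is the functional theta |-> int_A (F . grad theta + d theta)
   of Green's formula, so here theta need not vanish near the boundary. *)
Definition zero_normal_trace (A : set (R * R)) (F : R * R -> R * R)
    (d : R * R -> R) :=
  forall theta, test_fun setT theta ->
    \int[leb2]_(x in A) (dot (F x) (grad theta x) + d x * theta x) = 0.

(* [dg] is the distributional derivative of [g] along y3 in the open set [A]. *)
Definition weak_d3 (A : set (R * R * R)) (g dg : R * R * R -> R) :=
  forall phi, test_fun A phi ->
    \int[leb3]_(y in A) (g y * 'D_e3 phi y)
      = - (\int[leb3]_(y in A) (dg y * phi y)).

Definition Omega (omega : set (R * R)) (h : R * R -> R) : set (R * R * R) :=
  [set y | omega y.1 /\ 0 < y.2 < h y.1].

(* [w] is in V^q_{y3}(A), with derivative [dw]. *)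
Definition V3 (A : set (R * R * R)) (q : R) (w dw : R * R * R -> R) : Prop :=
  [/\ Lp_on leb3 A q%:E w, Lp_on leb3 A q%:E dw & weak_d3 A w dw].

(* A function [w] with y3-derivative [dw] has no pointwise boundary values;
   [g0] and [g1] are its traces on Gamma_0 and Gamma_1 (both parametrized by
   omega) in the sense of Green's formula, in which n_3 dS is -dy' on Gamma_0
   and dy' on Gamma_1. *)
Definition has_traces (omega : set (R * R)) (h : R * R -> R)
    (w dw : R * R * R -> R) (g0 g1 : R * R -> R) : Prop :=
  forall phi, test_fun [set y | omega y.1] phi ->
    \int[leb3]_(y in Omega omega h) (w y * 'D_e3 phi y + dw y * phi y)
      = \int[leb2]_(x in omega) (g1 x * phi (x, h x) - g0 x * phi (x, 0)).

(* V~(y') = int_0^{h(y')} u~(y', y3) dy3, with V~' and V~_3 as components. *)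
Definition reynolds (h : R * R -> R) (u : R * R * R -> R * R * R)
    (x : R * R) : R * R * R :=
  ((\int[lebesgue_measure]_(z in `[0, h x]) (u (x, z)).1.1,
    \int[lebesgue_measure]_(z in `[0, h x]) (u (x, z)).1.2),
   \int[lebesgue_measure]_(z in `[0, h x]) (u (x, z)).2).

Definition carreau_visc (lambda r : R) (s : R * R) : R :=
  (1 + lambda / 2 * enorm s ^+ 2) `^ (r / 2 - 1).

(* [u], with y3-derivative [du], and [p], with gradient [gp], solve the reduced
   Carreau Stokes system.  The momentum equation says that the distributional
   y3-derivative of minus the shear stress is the right-hand side. *)
Definition reduced_carreau_stokes (omega : set (R * R)) (h : R * R -> R)
    (r eta0 lambda : R) (f : R * R -> R * R)
    (u du : R * R * R -> R * R * R) (p : R * R -> R) (gp : R * R -> R * R) :=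
  let Om := Omega omega h in
  let stress y := carreau_visc lambda r (du y).1 *: (du y).1 in
  let force y := (2 / eta0) *: (f y.1 - gp y.1) in
  let V' x := (reynolds h u x).1 in
  [/\ weak_d3 Om (fun y => - (stress y).1) (fun y => (force y).1) /\
      weak_d3 Om (fun y => - (stress y).2) (fun y => (force y).2),
      weak_div omega V' (cst 0),
      zero_normal_trace omega V' (cst 0)
    & has_traces omega h (fun y => (u y).1.1) (fun y => (du y).1.1)
        (cst 0) (cst 0) /\
      has_traces omega h (fun y => (u y).1.2) (fun y => (du y).1.2)
        (cst 0) (cst 0)].

(* The radicand is required to be nonnegative because [Num.sqrt] is 0 on
   negative numbers, which would create spurious solutions for tau = 0. *)
Definition carreau_rel (r eta0 lambda tau zeta : R) : Prop :=
  let rad := 2 / lambda * ((zeta / eta0) `^ (2 / (r - 2)) - 1) in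
  [/\ 0 < zeta, 0 <= rad & tau = zeta * Num.sqrt rad].

Definition psi (r eta0 lambda tau : R) : R :=
  xget 0 [set zeta | carreau_rel r eta0 lambda tau zeta].

(* The integral over [-h/2, h/2] of (h/2 + xi) xi / psi(2 |g| |xi|). *)
Definition mobility (r eta0 lambda hx : R) (g : R * R) : R :=
  \int[lebesgue_measure]_(xi in `[- (hx / 2), hx / 2])
    ((hx / 2 + xi) * xi / psi r eta0 lambda (2 * enorm g * `|xi|)).

End Carreau.

(* Main.v *)
(* On almost every vertical line the momentum equation says that the stress
   sigma = visc(du) du is affine in z with slope -(2/eta0) g, g = f - grad p
   (du Bois-Reymond, tested against theta(x) zeta(z)), while the boundary
   conditions, tested with zeta = 1 and zeta = z on [0, h], say that du has zero
   integral over (0, h) and that int u = - int z du.  Comparing du(z) with its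
   reflection -du(h - z), whose stress differs from sigma by a constant, the
   strict monotonicity of the Carreau law forces the two to coincide, hence
   sigma = (2/eta0)(h/2 - z) g.  Inverting the law gives
   du = 2 (h/2 - z) g / psi(2 |g| |h/2 - z|), and - int z du is then twice the
   mobility times g.  The pressure law is the divergence equation and the flux
   condition for this velocity, divided by 2. *)
Require Import Defs.
From HB Require Import structures.
From mathcomp Require Import all_boot all_order all_algebra.
From mathcomp Require Import all_classical all_reals all_analysis.
From mathcomp Require Import measurable_realfun ess_sup_inf ring lra.
Import Order.TTheory GRing.Theory Num.Theory.
Import numFieldNormedType.Exports.
Local Open Scope classical_set_scope.
Local Open Scope ring_scope.

Set Implicit Arguments.
Unset Strict Implicit.
Unset Printing Implicit Defensive.

(** * Integrals *)

(** The velocity and its derivative are only of class L^r, so every relation has to be extracted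
    from integrals against products of one-dimensional bumps and then carried to almost every
    vertical line by Fubini. Reflection is the answer to an unknown integration constant: the stress
    on a line is k - (2/eta0) z g with k an unknown vector of the plane, and solving the condition
    int du = 0 for k directly would be a nonlinear problem in two unknowns. The difference of the
    stresses of du(z) and -du(h - z) is the constant q = 2k - (2/eta0) h g, and monotonicity yields
    q = 0, hence k, without solving anything. The weight (h/2 + xi) xi of the mobility comes from
    the substitution xi = h/2 - z in (h - z) du(z), whose integral is that of - z du(z) because du
    has zero integral. The integrability of the mobility integrand is thus inherited from du and
    never studied through [psi]. The factor eta0 disappears since [psi] at the stress 2 |g| |z| is
    eta0 times the viscosity. *)

Section AlmostEverywhere.
Context {d} {T : measurableType d} {R : realType}.
Variable mu : {measure set T -> \bar R}.

Lemma aeS (P Q : T -> Prop) : (forall x, P x -> Q x) ->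
  {ae mu, forall x, P x} -> {ae mu, forall x, Q x}.
Proof. exact: filterS. Qed.

Lemma aeS2 (P Q S : T -> Prop) : (forall x, P x -> Q x -> S x) ->
  {ae mu, forall x, P x} -> {ae mu, forall x, Q x} -> {ae mu, forall x, S x}.
Proof. exact: filterS2. Qed.

End AlmostEverywhere.

(* The mobility integrand contains [psi], whose measurability is not established;
   the integral is a supremum over simple functions, so that the next facts hold
   for arbitrary functions. *)
Section IntegralWithoutMeasurability.
Import HBNNSimple.
Local Open Scope ereal_scope.
Context {d} {T : measurableType d} {R : realType}.
Variable mu : {measure set T -> \bar R}.

(** A simple function below f, set to 0 on the exceptional null set, keeps its integral and lies
    below g everywhere; this compares the two suprema. *)
Let ge0_le_integral_ae (f g : T -> \bar R) :
  (forall x, 0 <= f x) -> (forall x, 0 <= g x) ->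
  {ae mu, forall x, f x = g x} -> \int[mu]_x f x <= \int[mu]_x g x.
Proof.
move=> f0 g0 [N [mN N0 fgN]].
rewrite !ge0_integralTE//; apply: ge_ereal_sup => _ [h /= hf <-].
have mNc : measurable (setT `\` N) by exact: measurableD.
have -> : sintegral mu h = sintegral mu (h \_ (setT `\` N)).
  rewrite -integral_nnsfun// -ge0_negligible_integral//.
  - by rewrite integral_nnsfun// patch_setT.
  - exact/measurable_EFinP.
  - by move=> x _; rewrite lee_fin.
apply: ereal_sup_ubound; exists (proj_nnsfun h mNc); last by rewrite -mrestrict.
move=> x; rewrite -[proj_nnsfun _ _ x]/((proj_nnsfun h mNc : T -> R) x) -mrestrict patchE.
case: ifPn => [|_]; last exact: g0.
rewrite inE => -[_ xN].
by apply: contrapT => H; apply: xN; apply: fgN => /= fgx; apply: H; rewrite -fgx.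
Qed.

Lemma ae_eq_integral_any (D : set T) (f g : T -> \bar R) :
  {ae mu, forall x, D x -> f x = g x} ->
  \int[mu]_(x in D) f x = \int[mu]_(x in D) g x.
Proof.
move=> fg.
have fgD : {ae mu, forall x, (f \_ D) x = (g \_ D) x}.
  apply: filterS fg => x fgx; rewrite !patchE.
  by case: ifPn => //; rewrite inE => /fgx.
have key (F G : T -> \bar R) : (forall x, 0 <= F x) -> (forall x, 0 <= G x) ->
    {ae mu, forall x, F x = G x} -> \int[mu]_x F x = \int[mu]_x G x.
  move=> F0 G0 FG; apply/eqP; rewrite eq_le; apply/andP.
  split; apply: ge0_le_integral_ae => //.
  by apply: filterS FG => x ->.
rewrite (integral_mkcond D) (integral_mkcond D g) integralE [RHS]integralE.
by congr (_ - _); apply: key => //; apply: filterS fgD => x;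
  rewrite ?funeposE ?funenegE => ->.
Qed.

Let ge0_integralZ_le (f : T -> \bar R) (k : R) : (0 < k)%R ->
  (forall x, 0 <= f x) -> k%:E * \int[mu]_x f x <= \int[mu]_x (k%:E * f x).
Proof.
move=> k0 f0; have k0' := ltW k0.
rewrite !ge0_integralTE//; last by move=> x; rewrite mule_ge0// lee_fin.
rewrite muleC -lee_pdivlMr//; apply: ge_ereal_sup => _ [h /= hf <-].
rewrite lee_pdivlMr// muleC -sintegralrM.
apply: ereal_sup_ubound; exists (scale_nnsfun h k0') => //= x.
by rewrite EFinM lee_pmul2l.
Qed.

Lemma integralZl_any (D : set T) (f : T -> \bar R) (k : R) : (0 < k)%R ->
  \int[mu]_(x in D) (k%:E * f x) = k%:E * \int[mu]_(x in D) f x.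
Proof.
move=> k0.
have key (F : T -> \bar R) : (forall x, 0 <= F x) ->
    \int[mu]_x (k%:E * F x) = k%:E * \int[mu]_x F x.
  move=> F0; apply/eqP; rewrite eq_le ge0_integralZ_le// andbT.
  rewrite -lee_pdivrMl//.
  (* The reverse inequality is the direct one applied to the factor k^-1 and the function k F. *)
  have -> : \int[mu]_x F x = \int[mu]_x (k^-1%:E * (k%:E * F x)).
    by apply: eq_integral => x _; rewrite muleA -EFinM mulVf ?gt_eqF// mul1e.
  apply: ge0_integralZ_le; first by rewrite invr_gt0.
  by move=> x; rewrite mule_ge0// lee_fin ltW.
rewrite (integral_mkcond D) (integral_mkcond D f) integralE [in RHS]integralE.
have E x : ((fun x => k%:E * f x) \_ D) x = k%:E * (f \_ D) x.
  by rewrite !patchE; case: ifP; rewrite ?mule0.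
have -> : (fun x => k%:E * f x) \_ D = (fun x => k%:E * (f \_ D) x) by exact/funext.
rewrite (ge0_funeposM _ (ltW k0)) (ge0_funenegM _ (ltW k0)) !key//.
have ky : k%:E * +oo = +oo by rewrite mulry gtr0_sg// mul1e.
have kNy : k%:E * -oo = -oo by rewrite mulrNy gtr0_sg// mul1e.
move: (\int[mu]_x _) (\int[mu]_x _) => [a| |] [b| |];
  rewrite ?(ky, kNy)//= ?(ky, kNy)//.
by rewrite -[b%:E + _]EFinD -!EFinM -[LHS]EFinD mulrDr mulrN.
Qed.

Lemma Rintegral_ae_eq (D : set T) (f g : T -> R) :
  {ae mu, forall x, D x -> f x = g x} ->
  (\int[mu]_(x in D) f x = \int[mu]_(x in D) g x)%R.
Proof.
move=> fg; congr fine; apply: ae_eq_integral_any.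
by apply: filterS fg => x /[apply] ->.
Qed.

Lemma RintegralZl_any (D : set T) (f : T -> R) (k : R) : (0 < k)%R ->
  (\int[mu]_(x in D) (k * f x) = k * \int[mu]_(x in D) f x)%R.
Proof.
move=> k0; rewrite /Rintegral.
under eq_integral do rewrite EFinM.
rewrite integralZl_any//.
by case: integral => [a| |]//=; rewrite (mulry, mulrNy) gtr0_sg// mul1e mulr0.
Qed.

Lemma RintegralZl_ge0 (f : T -> R) (k : R) : (0 <= k)%R ->
  (\int[mu]_x (k * f x) = k * \int[mu]_x f x)%R.
Proof.
rewrite le_eqVlt => /predU1P[<-|k0]; last exact: RintegralZl_any.
rewrite mul0r; transitivity (\int[mu]_(x in [set: T]) (0 : R))%R.
  by congr Rintegral; apply/funext => x; rewrite mul0r.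
by rewrite /Rintegral integral0.
Qed.

End IntegralWithoutMeasurability.

(** * The Carreau law *)

Section CarreauLaw.
Context {R : realType}.
Variables (r eta0 lambda : R).
Hypotheses (r_gt1 : 1 < r) (r_neq2 : r != 2) (eta0_gt0 : 0 < eta0)
  (lambda_gt0 : 0 < lambda).
Implicit Types s t tau zeta : R.

(** The scalar Carreau law: the norm of [carreau_visc lambda r v *: v] as a function of the norm s
    of v. It is an increasing bijection of the nonnegative half-line. *)
Definition carreau_shear s := s * (1 + lambda / 2 * s ^+ 2) `^ (r / 2 - 1).

Let w s := 1 + lambda / 2 * s ^+ 2.

Let w_ge1 s : 1 <= w s.
Proof. by rewrite lerDl mulr_ge0 ?sqr_ge0// divr_ge0 ?ltW. Qed.

Let w_gt0 s : 0 < w s. Proof. exact: lt_le_trans (w_ge1 s). Qed.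

Let le_w s t : 0 <= s -> s <= t -> w s <= w t.
Proof.
move=> s0 st; rewrite lerD2l ler_wpM2l//; first by rewrite divr_ge0 ?ltW.
by rewrite lerXn2r ?nnegrE// (le_trans s0).
Qed.

Lemma carreau_shear0 : carreau_shear 0 = 0.
Proof. by rewrite /carreau_shear mul0r. Qed.

(** For r >= 2 the viscosity factor is itself nondecreasing. For r < 2 it decreases like w^(-a) with
    a = 1 - r/2, but w t <= w s (t/s)^2 bounds the loss by (t/s)^(2a), which is less than the gain
    t/s because 2a = 2 - r < 1; this is where r > 1 enters. *)
Lemma carreau_shear_lt s t : 0 <= s -> s < t -> carreau_shear s < carreau_shear t.
Proof.
move=> s0 st; have t0 : 0 < t by exact: le_lt_trans st.
have [->|sN0] := eqVneq s 0.
  by rewrite carreau_shear0 mulr_gt0// powR_gt0// w_gt0.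
have {sN0}s0 : 0 < s by rewrite lt_neqAle eq_sym sN0.
rewrite /carreau_shear -!/(w _).
have [r2|r2] := leP 2 r.
  apply: (@lt_le_trans _ _ (t * w s `^ (r / 2 - 1))).
    by rewrite ltr_pM2r// powR_gt0.
  rewrite (ler_pM2l t0); apply: ge0_ler_powR; rewrite ?nnegrE ?(ltW (w_gt0 _))//.
    by lra.
  by apply: le_w; exact: ltW.
pose a : R := 1 - r / 2.
have a0 : 0 < a by rewrite /a; lra.
have -> : r / 2 - 1 = - a by rewrite /a; lra.
rewrite !powRN ltr_pdivrMr ?powR_gt0// mulrAC ltr_pdivlMr ?powR_gt0//.
have ts1 : 1 < t / s by rewrite ltr_pdivlMr// mul1r.
have ts0 : 0 < t / s by exact: lt_trans ts1.
have wts : w t <= w s * (t / s) ^+ 2.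
  rewrite (_ : w s * _ = (t / s) ^+ 2 + lambda / 2 * t ^+ 2); last first.
    by rewrite /w; field; rewrite gt_eqF.
  by rewrite lerD2r exprn_ege1// ltW.
apply: (@le_lt_trans _ _ (s * (w s `^ a * (t / s) `^ (2 * a)))).
  rewrite (ler_pM2l s0) powRrM powR_mulrn ?(ltW ts0)// -(powRM _ (ltW (w_gt0 s)) (sqr_ge0 _)).
  have e0 : 0 <= (t / s) ^+ 2 by exact: sqr_ge0.
  apply: ge0_ler_powR wts; rewrite ?nnegrE ?(mulr_ge0 (ltW (w_gt0 s)) e0) ?(ltW (w_gt0 _))//.
  exact: ltW.
rewrite mulrCA mulrC ltr_pM2r ?powR_gt0// mulrC -ltr_pdivlMr//.
rewrite -[ltRHS]powRr1 ?(ltW ts0)// /powR gt_eqF// ltr_expR ltr_pM2r ?ln_gt0//.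
by rewrite /a; move: r_gt1; lra.
Qed.

Lemma carreau_shear_le s t : 0 <= s -> s <= t -> carreau_shear s <= carreau_shear t.
Proof.
by move=> s0; rewrite le_eqVlt => /predU1P[->//|/(carreau_shear_lt s0)/ltW].
Qed.

Lemma carreau_shear_inj s t : 0 <= s -> 0 <= t ->
  carreau_shear s = carreau_shear t -> s = t.
Proof.
move=> s0 t0 st; have [/(carreau_shear_lt s0)|/(carreau_shear_lt t0)|//] := ltgtP s t;
by rewrite st ltxx.
Qed.

Lemma continuous_carreau_shear : continuous carreau_shear.
Proof.
move=> s; apply: cvgM; first exact: cvg_id.
apply: (@continuous_comp _ _ _ w (fun x => x `^ (r / 2 - 1))).
  apply: cvgD; first exact: cvg_cst.
  by apply: cvgM; [exact: cvg_cst|exact: exprn_continuous].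
apply/differentiable_continuous/derivable1_diffP/derivable_powR.
by rewrite in_itv/= andbT.
Qed.

Lemma carreau_shear_unbounded tau : exists2 s, 0 <= s & tau <= carreau_shear s.
Proof.
have [r2|r2] := leP 2 r.
  exists (Num.max 0 tau); first by rewrite le_max lexx.
  have M0 : 0 <= Num.max 0 tau by rewrite le_max lexx.
  apply: (@le_trans _ _ (Num.max 0 tau)); first by rewrite le_max lexx orbT.
  rewrite /carreau_shear -/(w _) ler_peMr//.
  rewrite -[leLHS](powRr0 (w (Num.max 0 tau))); apply: ler_powR => //.
  by lra.
pose a : R := 1 - r / 2.
have a0 : 0 < a by rewrite /a; lra.
pose c := (1 + lambda / 2) `^ a.
have c1 : 0 < 1 + lambda / 2 by rewrite addr_gt0// divr_gt0.
have c0 : 0 < c by exact: powR_gt0.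
(* For s >= 1, w s <= (1 + lambda/2) s^2, hence the shear is at least s^(r-1) / c; the second
   argument of the maximum makes this at least tau. *)
pose s := Num.max 1 ((Num.max 0 tau * c) `^ (r - 1)^-1).
have s1 : 1 <= s by rewrite le_max lexx.
have s0 : 0 < s by exact: lt_le_trans s1.
exists s; first exact: ltW.
apply: (@le_trans _ _ (s `^ (r - 1) / c)).
  rewrite ler_pdivlMr//.
  apply: (@le_trans _ _ (Num.max 0 tau * c)).
    by rewrite ler_wpM2r// ?(ltW c0)// le_max lexx orbT.
  have M0 : 0 <= Num.max 0 tau * c by rewrite mulr_ge0// ?le_max ?lexx// ltW.
  rewrite -[leLHS]powRr1// -[X in _ `^ X](@mulVf _ (r - 1)); last by move: r_gt1; lra.
  rewrite powRrM; apply: ge0_ler_powR; rewrite ?nnegrE ?powR_ge0//.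
  - by move: r_gt1; lra.
  - exact: ltW.
  - by rewrite le_max lexx orbT.
rewrite /carreau_shear -/(w _); have -> : r / 2 - 1 = - a by rewrite /a; lra.
rewrite powRN ler_pdivrMr// mulrAC ler_pdivlMr ?powR_gt0//.
apply: (@le_trans _ _ (s `^ (r - 1) * (((1 + lambda / 2) * s ^+ 2) `^ a))).
  rewrite ler_wpM2l ?powR_ge0//; apply: ge0_ler_powR;
    rewrite ?nnegrE ?(ltW (w_gt0 _)) ?(ltW a0)//.
    by rewrite mulr_ge0 ?exprn_ge0 ?ltW.
  by rewrite /w mulrDl mul1r lerD2r exprn_ege1.
rewrite (powRM _ (ltW c1) (sqr_ge0 s)) -/c -powR_mulrn ?(ltW s0)// -powRrM.
rewrite mulrCA -powRD; last first.
  by rewrite (gt_eqF s0) implybT.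
rewrite [X in _ `^ X](_ : _ = 1); last by rewrite /a; lra.
by rewrite powRr1 ?(ltW s0)// mulrC.
Qed.

Lemma carreau_shear_surj tau : 0 <= tau -> exists2 s, 0 <= s & carreau_shear s = tau.
Proof.
move=> tau0; have [S S0 tauS] := carreau_shear_unbounded tau.
have [||c] := @IVT R carreau_shear 0 S tau S0.
- exact/continuous_subspaceT/continuous_carreau_shear.
- by rewrite carreau_shear0 ge_min tau0/= le_max tauS orbT.
- by rewrite in_itv/= => /andP[c0 _] cE; exists c.
Qed.

Let r2N0 : r - 2 != 0. Proof. by rewrite subr_eq0. Qed.

(* [s] is the norm of the velocity gradient, [zeta] is the viscosity eta0 times
   [carreau_visc], and [tau] is the norm of the stress. *)
Lemma carreau_relP tau zeta : carreau_rel r eta0 lambda tau zeta <->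
  exists s, [/\ 0 <= s, zeta = eta0 * w s `^ (r / 2 - 1)
               & tau = eta0 * carreau_shear s].
Proof.
have l2 : 2 / lambda * (lambda / 2) = 1.
  by rewrite mulrC -mulrA mulKf ?pnatr_eq0// divff ?gt_eqF.
have ex : 2 / (r - 2) * (r / 2 - 1) = 1.
  by rewrite (_ : r / 2 - 1 = (r - 2) / 2); [field|lra]; rewrite r2N0.
split.
  move=> [zeta0 rad0 tauE].
  set rad := 2 / lambda * _ in rad0 tauE.
  (* The exponents 2/(r - 2) and r/2 - 1 are inverse to each other, so the radicand is s^2 once zeta
     is written as eta0 w(s)^(r/2-1); its sign condition allows the square root to be undone. *)
  exists (Num.sqrt rad).
  have wE : w (Num.sqrt rad) = (zeta / eta0) `^ (2 / (r - 2)).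
    rewrite /w sqr_sqrtr// /rad mulrA [lambda / 2 * _]mulrC l2 mul1r; lra.
  have zE : zeta = eta0 * w (Num.sqrt rad) `^ (r / 2 - 1).
    rewrite wE -powRrM ex powRr1 ?divr_ge0 ?ltW//.
    by rewrite mulrC divfK ?gt_eqF.
  split => //.
  by rewrite /carreau_shear -/(w _) mulrCA mulrC -zE.
move=> [s [s0 -> ->]].
have E : eta0 * w s `^ (r / 2 - 1) / eta0 = w s `^ (r / 2 - 1).
  by rewrite mulrC mulKf ?gt_eqF.
rewrite /carreau_rel E -powRrM [(r / 2 - 1) * _]mulrC ex powRr1 ?(ltW (w_gt0 _))//.
have -> : 2 / lambda * (w s - 1) = s ^+ 2.
  by rewrite /w addrC addKr mulrA l2 mul1r.
split; first by rewrite mulr_gt0 ?powR_gt0.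
  exact: sqr_ge0.
by rewrite sqrtr_sqr ger0_norm// /carreau_shear -/(w _) mulrA mulrAC.
Qed.

(** By [carreau_relP] the solutions are parametrized by the shear rates s >= 0 with eta0
    [carreau_shear] s = tau, and the scalar law is a bijection of the half-line. *)
Lemma carreau_rel_unique tau : 0 <= tau ->
  exists! zeta, carreau_rel r eta0 lambda tau zeta.
Proof.
move=> tau0; have [|s s0 sE] := @carreau_shear_surj (tau / eta0).
  by rewrite divr_ge0// ltW.
exists (eta0 * w s `^ (r / 2 - 1)); split.
  apply/carreau_relP; exists s; split => //.
  by rewrite sE mulrC divfK ?gt_eqF.
move=> zeta /carreau_relP[t [t0 -> tauE]].
congr (_ * w _ `^ _); apply: carreau_shear_inj => //.
by rewrite sE tauE mulrC mulKf ?gt_eqF.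
Qed.

Lemma psiE tau zeta : 0 <= tau -> carreau_rel r eta0 lambda tau zeta ->
  psi r eta0 lambda tau = zeta.
Proof.
move=> tau0 tz; have [z [_ uz]] := carreau_rel_unique tau0.
rewrite /psi; case: xgetP => [y -> /= ty|/(_ zeta)//].
by rewrite -(uz _ ty) -(uz _ tz).
Qed.

End CarreauLaw.

(** * Strict monotonicity and inversion of the vector Carreau law *)

Section CarreauVector.
Context {R : realType}.
Variables (r eta0 lambda : R).
Hypotheses (r_gt1 : 1 < r) (r_neq2 : r != 2) (eta0_gt0 : 0 < eta0)
  (lambda_gt0 : 0 < lambda).
Implicit Types a b g s : R * R.

Lemma dot_ge0 a : 0 <= dot a a.
Proof. by rewrite /dot -!expr2 addr_ge0 ?sqr_ge0. Qed.

Lemma enorm_ge0 a : 0 <= enorm a. Proof. exact: sqrtr_ge0. Qed.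

Lemma enorm_sqr a : enorm a ^+ 2 = dot a a.
Proof. by rewrite sqr_sqrtr// dot_ge0. Qed.

Lemma enormZ (k : R) a : enorm (k *: a) = `|k| * enorm a.
Proof.
rewrite /enorm (_ : dot (k *: a) (k *: a) = k ^+ 2 * dot a a); last first.
  by rewrite /dot /= /GRing.scale/=; ring.
by rewrite sqrtrM ?sqr_ge0// sqrtr_sqr.
Qed.

Lemma dot_le_enorm a b : dot a b <= enorm a * enorm b.
Proof.
rewrite (le_trans (ler_norm _))// -ler_sqr ?nnegrE ?mulr_ge0 ?enorm_ge0//.
rewrite exprMn !enorm_sqr real_normK ?num_real// -subr_ge0.
(* Lagrange's identity in the plane. *)
rewrite (_ : _ - _ = (a.1 * b.2 - a.2 * b.1) ^+ 2) ?sqr_ge0// /dot; ring.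
Qed.

Lemma enorm0_eq0 a : enorm a = 0 -> a = 0.
Proof.
move=> /(congr1 (fun x => x ^+ 2)); rewrite enorm_sqr expr0n/= /dot -!expr2.
move=> /eqP; rewrite paddr_eq0 ?sqr_ge0// !sqrf_eq0 => /andP[/eqP a1 /eqP a2].
by case: a a1 a2 => /= ? ? -> ->.
Qed.

Lemma carreau_visc_gt0 s : 0 < carreau_visc lambda r s.
Proof.
rewrite powR_gt0// ltr_pwDl// mulr_ge0 ?sqr_ge0// divr_ge0 ?ltW//.
Qed.

Let viscE s : carreau_visc lambda r s * enorm s = carreau_shear r lambda (enorm s).
Proof. by rewrite mulrC. Qed.

(** Splits the pairing into a radial part, controlled by the monotone scalar law, and an angular
    part, a positive multiple of the defect in the Cauchy-Schwarz inequality. *)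
Let monoE a b (p := carreau_visc lambda r a) (q := carreau_visc lambda r b) :
  dot (p *: a - q *: b) (a - b) =
    (p * enorm a - q * enorm b) * (enorm a - enorm b) +
    (p + q) * (enorm a * enorm b - dot a b).
Proof.
rewrite mulrBl !mulrBr (_ : p * enorm a * enorm a = p * dot a a); last first.
  by rewrite -enorm_sqr; ring.
rewrite (_ : q * enorm b * enorm b = q * dot b b); last first.
  by rewrite -enorm_sqr; ring.
by rewrite /dot /= /GRing.scale/=; ring.
Qed.

Let shear_mono a b : 0 <= (carreau_visc lambda r a * enorm a -
  carreau_visc lambda r b * enorm b) * (enorm a - enorm b).
Proof.
rewrite !viscE; have [ab|ab] := leP (enorm a) (enorm b).
  rewrite mulr_le0// subr_le0//.
  by apply: carreau_shear_le => //; exact: enorm_ge0.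
rewrite mulr_ge0// subr_ge0; last exact: ltW.
by apply: carreau_shear_le => //; [exact: enorm_ge0|exact: ltW].
Qed.

Lemma carreau_monotone a b :
  0 <= dot (carreau_visc lambda r a *: a - carreau_visc lambda r b *: b) (a - b).
Proof.
rewrite monoE addr_ge0 ?shear_mono// mulr_ge0 ?subr_ge0 ?dot_le_enorm//.
by rewrite addr_ge0 ?ltW ?carreau_visc_gt0.
Qed.

(** Both nonnegative parts of [monoE] must vanish: the radial one forces equal norms by injectivity
    of the scalar law, the angular one then forces equality in Cauchy-Schwarz, and |a - b|^2 expands
    to 0. *)
Lemma carreau_strict_monotone a b :
  dot (carreau_visc lambda r a *: a - carreau_visc lambda r b *: b) (a - b) = 0 ->
  a = b.
Proof.
rewrite monoE => /eqP; rewrite paddr_eq0 ?shear_mono//; last first.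
  by rewrite mulr_ge0 ?subr_ge0 ?dot_le_enorm// addr_ge0 ?ltW ?carreau_visc_gt0.
rewrite !mulf_eq0 => /andP[ab dab].
have {}ab : enorm a = enorm b.
  move: ab; rewrite !subr_eq0 !viscE => /orP[/eqP|/eqP//].
  by apply: carreau_shear_inj => //; exact: enorm_ge0.
move: dab; rewrite gt_eqF ?addr_gt0 ?carreau_visc_gt0//= subr_eq0 ab => /eqP dab.
apply/eqP; rewrite -subr_eq0; apply/eqP/enorm0_eq0/eqP.
rewrite -sqrf_eq0 enorm_sqr (_ : dot (a - b) (a - b) =
  dot a a + dot b b - 2 * dot a b); last by rewrite /dot/=; ring.
by rewrite -dab -!enorm_sqr ab; apply/eqP; ring.
Qed.

(** Taking norms gives 2 |g| |z| = eta0 [carreau_shear] |s|, so [psi] at this stress is eta0 times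
    the viscosity of s, and dividing the law by the viscosity gives s. The degenerate cases z = 0
    and g = 0 need no separate treatment. *)
Lemma carreau_law_inv s g (z : R) :
  carreau_visc lambda r s *: s = (2 / eta0 * z) *: g ->
  s = (2 * z / psi r eta0 lambda (2 * enorm g * `|z|)) *: g.
Proof.
move=> sE; have v0 := carreau_visc_gt0 s.
have tauE : 2 * enorm g * `|z| = eta0 * carreau_shear r lambda (enorm s).
  rewrite -viscE -[carreau_visc _ _ _](gtr0_norm v0) -enormZ sE enormZ.
  rewrite !normrM (gtr0_norm (x := eta0^-1)) ?invr_gt0// (gtr0_norm (x := 2))//.
  by field; rewrite gt_eqF.
have -> : psi r eta0 lambda (2 * enorm g * `|z|) = eta0 * carreau_visc lambda r s.
  apply: psiE => //; first by rewrite !mulr_ge0 ?enorm_ge0.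
  by apply/carreau_relP => //; exists (enorm s); split => //; exact: enorm_ge0.
rewrite (_ : 2 * z / _ = (carreau_visc lambda r s)^-1 * (2 / eta0 * z)); last first.
  by field; rewrite !gt_eqF.
by rewrite -scalerA -sE scalerA mulVf ?gt_eqF// scale1r.
Qed.

End CarreauVector.

(** * Smooth functions and bumps *)

Section CkTheory.
Context {R : realType} {V : normedModType R}.
Implicit Types f g : V -> R.

Lemma CkS k f : Ck_on [set: V] k.+1 f -> Ck_on [set: V] k f.
Proof.
elim: k f => [|k IH] f [fc fD]; split => // v.
by have [fd fk] := fD v; split => //; exact: IH.
Qed.

Lemma Ck_continuous k f : Ck_on [set: V] k f -> continuous f.
Proof. by case: k => [|k] [fc _] x; exact: fc. Qed.

Lemma Ck_cst k (c : R) : Ck_on [set: V] k (cst c).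
Proof.
elim: k c => [|k IH] c; split => //; try by move=> x _; exact: cvg_cst.
move=> v; split; first by move=> x _; exact: derivable_cst.
rewrite (_ : (fun x => _) = cst 0); first exact: IH.
by apply/funext => x; exact: derive_cst.
Qed.

Lemma CkD k f g : Ck_on [set: V] k f -> Ck_on [set: V] k g ->
  Ck_on [set: V] k (fun x => f x + g x).
Proof.
elim: k f g => [|k IH] f g [fc fD] [gc gD]; split => //;
  try by move=> x _; apply: continuousD; [exact: fc|exact: gc].
move=> v; have [fd fk] := fD v; have [gd gk] := gD v; split.
  by move=> x _; apply: derivableD; [exact: fd|exact: gd].
rewrite (_ : (fun x => _) = (fun x => 'D_v f x + 'D_v g x)); first exact: IH.
by apply/funext => x; apply: deriveD; [exact: fd|exact: gd].
Qed.

Lemma CkM k f g : Ck_on [set: V] k f -> Ck_on [set: V] k g ->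
  Ck_on [set: V] k (fun x => f x * g x).
Proof.
elim: k f g => [|k IH] f g /[dup] Cf [fc fD] /[dup] Cg [gc gD]; split => //;
  try by move=> x _; apply: continuousM; [exact: fc|exact: gc].
move=> v; have [fd fk] := fD v; have [gd gk] := gD v; split.
  by move=> x _; apply: derivableM; [exact: fd|exact: gd].
rewrite (_ : (fun x => _) = (fun x => f x * 'D_v g x + g x * 'D_v f x)).
  by apply: CkD; apply: IH => //; exact: CkS.
by apply/funext => x; apply: deriveM; [exact: fd|exact: gd].
Qed.

(** The derivative along v is the derivative of g along L v, composed with the same affine map, so
    the induction on k closes. Linearity of L is stated in the shape in which the difference
    quotient uses it. *)
Lemma Ck_comp_affine k (g : R -> R) (L : V -> R) (c : R) :
  (forall (h : R) v x, L (h *: v + x) = h * L v + L x) -> continuous L ->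
  Ck_on [set: R] k g -> Ck_on [set: V] k (fun x => g (L x + c)).
Proof.
move=> lL cL; elim: k g => [|k IH] g /[dup] Cg [gc gD]; split => //.
1,2: move=> x _; apply: (@continuous_comp V R R (fun x => L x + c) g x);
    [apply: cvgD; [exact: cL|exact: cvg_cst]|exact: (gc (L x + c) I)].
move=> v; have [gd gk] := gD (L v).
have E x : (fun h : R => h^-1 *: (((fun x => g (L x + c)) \o shift x) (h *: v) - g (L x + c)))
   = (fun h : R => h^-1 *: ((g \o shift (L x + c)) (h *: L v) - g (L x + c))).
  apply/funext => h /=; congr (_ *: (g _ - _)).
  by rewrite lL addrA.
split.
  by move=> x _; rewrite /derivable E; exact: gd.
rewrite (_ : (fun x => _) = (fun x => 'D_(L v) g (L x + c))); first exact: (IH _ gk).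
by apply/funext => x; rewrite /derive E.
Qed.

Lemma smooth_onM f g : smooth_on setT f -> smooth_on setT g ->
  smooth_on setT (fun x => f x * g x).
Proof. by move=> Sf Sg k; exact: CkM. Qed.

Lemma smooth_on_comp_affine (g : R -> R) (L : V -> R) (c : R) :
  (forall (h : R) v x, L (h *: v + x) = h * L v + L x) -> continuous L ->
  smooth_on [set: R] g -> smooth_on [set: V] (fun x => g (L x + c)).
Proof. by move=> lL cL Sg k; exact: Ck_comp_affine. Qed.

End CkTheory.

Section SmoothReal.
Context {R : realType}.
Implicit Types f : R -> R.

Lemma Ck_is_derive k f (f' : R -> R) : (forall x : R, is_derive x (1 : R) f (f' x)) ->
  Ck_on [set: R] k f' -> Ck_on [set: R] k.+1 f.
Proof.
move=> fd Cf'.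
have df x : differentiable f x by apply/derivable1_diffP.
split; first by move=> x _; exact/differentiable_continuous.
move=> v; split; first by move=> x _; exact: diff_derivable.
rewrite (_ : (fun x => _) = (fun x => cst v x * f' x)).
  by apply: CkM => //; exact: Ck_cst.
apply/funext => x; rewrite deriveE//.
rewrite -[v in LHS]mulr1 -[_ * 1]/(v *: 1) linearZ/= -deriveE//.
by rewrite derive_val.
Qed.

Lemma smooth_on_id : smooth_on [set: R] id.
Proof.
case=> [|k]; first by split => // x _; exact: cvg_id.
by apply: (@Ck_is_derive _ _ (cst 1)); exact: Ck_cst.
Qed.

(* [flat p] is [p(1/t) exp(-1/t)] for [t > 0]; these functions are stable under
   differentiation, hence smooth. *)
Definition flat (p : {poly R}) (t : R) : R :=
  if 0 < t then p.[t^-1] * expR (- t^-1) else 0.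

Lemma horner_le_pow (p : {poly R}) : exists2 M, 0 <= M &
  forall u, 1 <= u -> `|p.[u]| <= M * u ^+ size p.
Proof.
exists (\sum_(i < size p) `|p`_i|) => [|u u1]; first exact: sumr_ge0.
rewrite horner_coef mulr_suml; apply: le_trans (ler_norm_sum _ _ _) _.
apply: ler_sum => i _; rewrite normrM ler_wpM2l// ger0_norm.
  by rewrite ler_weXn2l// ltnW.
by rewrite exprn_ge0// (le_trans ler01).
Qed.

(** With u = 1/t >= 1, the polynomial grows at most like u^N and exp(-u) <= (N+2)! / u^(N+2), which
    leaves t^2. A quadratic bound is what makes the derivative at 0 exist and vanish. *)
Lemma flat_le_sqr (p : {poly R}) : exists2 C, 0 <= C &
  forall t, t <= 1 -> `|flat p t| <= C * t ^+ 2.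
Proof.
have [M M0 pM] := horner_le_pow p.
set N := size p in pM.
exists (M * (N.+2)`!%:R); first by rewrite mulr_ge0.
move=> t t1; rewrite /flat; case: ifPn => [t0|_]; last first.
  by rewrite normr0 mulr_ge0 ?sqr_ge0// mulr_ge0.
have u1 : 1 <= t^-1 by rewrite -invr1 lef_pV2 ?posrE.
have u0 : 0 < t^-1 by rewrite invr_gt0.
rewrite normrM [X in _ * X <= _]ger0_norm ?expR_ge0//.
apply: (@le_trans _ _ (M * t^-1 ^+ N * (N.+2`!%:R / t^-1 ^+ N.+2))).
  apply: ler_pM => //; first exact: pM.
  rewrite expRN -[leRHS]invrK lef_pV2 ?posrE ?expR_gt0//; last first.
    by rewrite invr_gt0 divr_gt0 ?exprn_gt0 ?ltr0n ?fact_gt0.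
  rewrite invf_div; apply: le_trans (expR_ge1Dxn N.+1 (ltW u0)).
  by rewrite lerDr.
rewrite -!mulrA ler_wpM2l// mulrCA ler_wpM2l//.
by rewrite !exprVn invrK -addn2 exprD mulKf// expf_neq0// gt_eqF.
Qed.

(** For t > 0 the derivative of p(1/t) exp(-1/t) is t^(-2) (p - p')(1/t) exp(-1/t), which explains
    the polynomial X^2 (p - p'). The point 0, where the two formulas meet, is handled by
    [flat_le_sqr]. *)
Lemma is_derive_flat (p : {poly R}) (x : R) :
  is_derive x (1 : R) (flat p) (flat ('X^2 * (p - p^`())) x).
Proof.
have [x0|x0|->] := ltgtP x 0.
- rewrite (_ : flat _ x = 0); last by rewrite /flat ltNge (ltW x0).
  apply: (@near_eq_is_derive _ _ _ (cst 0)).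
    near=> y; rewrite /flat ltNge ltW//=; near: y.
    exact: lt_nbhsl.
- rewrite [flat _ x]/flat x0.
  suff H : is_derive x (1 : R) (fun t => p.[t^-1] * expR (- t^-1))
      (('X^2 * (p - p^`())).[x^-1] * expR (- x^-1)).
    apply: near_eq_is_derive H.
    near=> y; rewrite /flat (_ : 0 < y)//; near: y.
    exact: lt_nbhsr.
  + have xN0 : x != 0 by rewrite gt_eqF.
    have iv : is_derive x (1 : R) (fun t : R => t^-1) (- x ^- 2).
      have H : is_derive x (1 : R) (fun t : R => t^-1) (- x ^- 2 *: (1 : R)).
        exact: (@is_deriveV _ id).
      by rewrite /GRing.scale/= mulr1 in H.
    have pv : is_derive x (1 : R) (fun t : R => p.[t^-1]) (p^`().[x^-1] * (- x ^- 2)).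
      exact: (is_derive1_comp (is_derive_poly p x^-1) iv).
    have ev : is_derive x (1 : R) (fun t : R => expR (- t^-1)) (expR (- x^-1) * x ^- 2).
      have H := @is_derive1_comp _ expR (- [eta GRing.inv]) x _ _
        (is_derive_expR _) (is_deriveN iv).
      by rewrite opprK in H; exact: H.
    have := is_deriveM pv ev.
    rewrite (_ : _ *: _ + _ *: _ = ('X^2 * (p - p^`())).[x^-1] * expR (- x^-1)); first by [].
    have -> : ('X^2 * (p - p^`())).[x^-1] = x ^- 2 * (p.[x^-1] - p^`().[x^-1]).
      by rewrite !hornerE exprVn.
    transitivity (p.[x^-1] * (expR (- x^-1) * x ^- 2)
      + expR (- x^-1) * (p^`().[x^-1] * - x ^- 2)); first by [].
    by ring.
- rewrite (_ : flat _ 0 = 0); last by rewrite /flat ltxx.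
  have [C C0 HC] := flat_le_sqr p.
  have cv : h^-1 *: ((flat p \o shift 0) (h *: 1) - flat p 0) @[h --> 0^'] --> (0 : R).
    apply/cvgr0Pnorm_lt => e e0; near=> h.
    rewrite /= addr0 [h *: 1]mulr1 [flat p 0]/flat ltxx subr0.
    have h0 : h != 0 by near: h; exact: nbhs_dnbhs_neq.
    rewrite normrM normfV mulrC ltr_pdivrMr ?normr_gt0//.
    have h1 : `|h| < 1 by near: h; exact: dnbhs0_lt.
    apply: le_lt_trans (HC _ (ltW (le_lt_trans (ler_norm h) h1))) _.
    rewrite -real_normK ?num_real// expr2 mulrA ltr_pM2r ?normr_gt0//.
    have hC : `|h| < e / (C + 1) by near: h; apply: dnbhs0_lt; rewrite divr_gt0// ltr_wpDl.
    apply: (@le_lt_trans _ _ ((C + 1) * `|h|)); first by rewrite ler_wpM2r// lerDl.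
    by rewrite mulrC -ltr_pdivlMr// ltr_wpDl.
  by apply: DeriveDef; [apply/cvg_ex; exists 0|apply/cvg_lim].
Unshelve. all: by end_near.
Qed.

Lemma smooth_flat (p : {poly R}) : smooth_on [set: R] (flat p).
Proof.
move=> k; elim: k p => [|k IH] p.
  split => // x _; apply/differentiable_continuous/derivable1_diffP.
  by have := is_derive_flat p x.
exact: (Ck_is_derive (is_derive_flat p) (IH _)).
Qed.

End SmoothReal.

Section Bumps.
Context {R : realType}.
Implicit Types (a b t : R) (f F : R -> R).
Local Notation mu := (@lebesgue_measure R).

(* Since exp(-1/(n t)) tends to 1 for every t > 0, [bump n a b] tends pointwise to
   the indicator of ]a, b[, boundedly. *)
Definition bump (n : nat) a b t : R :=
  flat 1 (n.+1%:R * (t - a)) * flat 1 (n.+1%:R * (b - t)).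

Lemma flat1_ge0 t : 0 <= flat 1 t.
Proof. by rewrite /flat; case: ifP => // _; rewrite hornerC mul1r expR_ge0. Qed.

Lemma flat1_le1 t : flat 1 t <= 1.
Proof.
rewrite /flat; case: ifP => // t0; rewrite hornerC mul1r -expR0 ler_expR.
by rewrite oppr_le0 invr_ge0 ltW.
Qed.

Lemma flat1_gt0 t : 0 < t -> 0 < flat 1 t.
Proof. by move=> t0; rewrite /flat t0 hornerC mul1r expR_gt0. Qed.

Lemma flat_le0 p t : t <= 0 -> flat p t = 0.
Proof. by move=> t0; rewrite /flat ltNge t0. Qed.

Lemma smooth_bump n a b : smooth_on [set: R] (bump n a b).
Proof.
apply: smooth_onM.
- rewrite (_ : (fun x => _) = (fun x => flat 1 (n.+1%:R * x + - (n.+1%:R * a)))).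
    apply: (@smooth_on_comp_affine _ _ _ (fun x : R => n.+1%:R * x)).
    + by move=> h v x; rewrite /GRing.scale/=; ring.
    + by move=> x; apply: cvgM; [exact: cvg_cst|exact: cvg_id].
    + exact: smooth_flat.
  by apply/funext => x; rewrite mulrBr.
- rewrite (_ : (fun x => _) = (fun x => flat 1 (- n.+1%:R * x + n.+1%:R * b))).
    apply: (@smooth_on_comp_affine _ _ _ (fun x : R => - n.+1%:R * x)).
    + by move=> h v x; rewrite /GRing.scale/=; ring.
    + by move=> x; apply: cvgM; [exact: cvg_cst|exact: cvg_id].
    + exact: smooth_flat.
  by apply/funext => x; rewrite mulrBr addrC mulNr.
Qed.

Lemma bump_ge0 n a b t : 0 <= bump n a b t.
Proof. by rewrite mulr_ge0 ?flat1_ge0. Qed.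

Lemma bump_le1 n a b t : bump n a b t <= 1.
Proof. by rewrite -[leRHS]mulr1 ler_pM ?flat1_ge0 ?flat1_le1. Qed.

Lemma bump_out n a b t : t \notin `]a, b[ -> bump n a b t = 0.
Proof.
rewrite in_itv/= negb_and -!leNgt /bump => /orP[ta|bt].
  by rewrite (@flat_le0 _ (_ * (t - a))) ?mul0r// mulr_ge0_le0// subr_le0.
by rewrite (@flat_le0 _ (_ * (b - t))) ?mulr0// mulr_ge0_le0// subr_le0.
Qed.

Lemma bump_gt0 n a b t : t \in `]a, b[ -> 0 < bump n a b t.
Proof.
by rewrite in_itv/= => /andP[ta tb]; rewrite mulr_gt0 ?flat1_gt0// mulr_gt0// subr_gt0.
Qed.

Lemma bump_cvg a b t : bump n a b t @[n --> \oo] --> (\1_(`]a, b[%classic : set R) t : R).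
Proof.
have cv c : 0 < c -> flat 1 (n.+1%:R * c) @[n --> \oo] --> (1 : R).
  move=> c0.
  rewrite (_ : (fun n => _) = (fun n => expR (- (c^-1 * n.+1%:R^-1)))); last first.
    by apply/funext => n; rewrite /flat pmulr_rgt0// c0 hornerC mul1r invfM mulrC.
  rewrite -[X in _ --> X]expR0; apply: continuous_cvg; first exact: continuous_expR.
  rewrite -[X in _ --> X]oppr0; apply: cvgN; rewrite -[X in _ --> X](mulr0 c^-1).
  have H : (n.+1%:R^-1 : R) @[n --> \oo] --> (0 : R) by exact: cvg_harmonic.
  exact: (cvgM (cvg_cst c^-1) H).
have [tab|tab] := boolP (t \in `]a, b[).
  rewrite indicE mem_set//= -[X in _ --> X]mulr1.
  move: tab; rewrite in_itv/= => /andP[ta tb].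
  by apply: cvgM; apply: cv; rewrite subr_gt0.
rewrite indicE memNset; last exact/negP.
under eq_fun do rewrite bump_out//.
exact: cvg_cst.
Qed.

Lemma smooth_continuous f : smooth_on [set: R] f -> continuous f.
Proof. by move=> /(_ 0%N)/Ck_continuous. Qed.

Lemma continuous_supp_integrable f a b : continuous f ->
  (forall t, t \notin `[a, b] -> f t = 0) -> mu.-integrable setT (EFin \o f).
Proof.
move=> cf f0.
have : mu.-integrable setT ((EFin \o f) \_ `[a, b]).
  apply: (integrable_mkcond _ _).1 => //.
  have H : {within `[a, b], continuous f} by exact: continuous_subspaceT.
  exact: (continuous_compact_integrable (@segment_compact _ a b) H).
apply: eq_integrable => //.
move=> x _; rewrite patchE; case: ifPn => // /negP xab.
by rewrite /= f0//; apply/negP => /mem_set.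
Qed.

(** F is the integral of f from minus infinity; it vanishes to the left of a by the support
    condition and to the right of b because the total integral is 0. *)
Lemma smooth_primitive f a b : a <= b -> smooth_on [set: R] f ->
  (forall t, t \notin `]a, b[ -> f t = 0) -> \int[mu]_x f x = 0 ->
  exists F, [/\ smooth_on [set: R] F, forall x : R, is_derive x (1 : R) F (f x)
    & forall t, t \notin `]a, b[ -> F t = 0].
Proof.
move=> ab sf f0 If; have cf := smooth_continuous sf.
have fi := @continuous_supp_integrable f a b cf.
have {}fi : mu.-integrable setT (EFin \o f).
  by apply: fi => t tab; apply: f0; apply: contra tab; exact: subset_itv_oo_cc.
pose F x := \int[mu]_(t in [set` Interval -oo%O (BRight x)]) f t.
have dF (x : R) : is_derive x (1 : R) F (f x).
  have [||||dF FE] := @continuous_FTC1 R f -oo%O x (x + 1).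
  - by rewrite ltrDl.
  - exact: integrableS fi.
  - exact: ltNyr.
  - exact: cf.
  by apply: DeriveDef => //; rewrite -derive1E.
exists F; split => //.
  move=> [|k].
    split => // x _; apply/differentiable_continuous/derivable1_diffP.
    by have := dF x.
  exact: (Ck_is_derive dF).
move=> t; rewrite in_itv/= negb_and -!leNgt => /orP[ta|bt].
  rewrite /F Rintegral_mkcond.
  rewrite (_ : _ \_ _ = cst 0); first by rewrite /Rintegral integral0.
  apply/funext => x; rewrite patchE; case: ifPn => //; rewrite inE/= in_itv/= => xt.
  by rewrite f0// in_itv/= negb_and -!leNgt (le_trans xt ta).
rewrite -If /F Rintegral_mkcond; congr Rintegral.
apply/funext => x; rewrite patchE; case: ifPn => //; rewrite notin_setE/= in_itv/=.
move/negP; rewrite -ltNge => tx.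
by rewrite f0// in_itv/= negb_and -!leNgt (le_trans bt (ltW tx)) orbT.
Qed.

Lemma bump_integral_gt0 a b : a < b -> 0 < \int[mu]_t bump 0 a b t.
Proof.
move=> ab; rewrite lt_neqAle; apply/andP; split; last first.
  by apply: Rintegral_ge0 => t _; exact: bump_ge0.
apply/eqP => I0.
have cb := smooth_continuous (smooth_bump 0 a b).
have ib : mu.-integrable setT (EFin \o bump 0 a b).
  apply: (@continuous_supp_integrable _ a b) => // t tab.
  by apply: bump_out; apply: contra tab; exact: subset_itv_oo_cc.
have [/= N [mN N0 subN]] : ae_eq mu setT (EFin \o bump 0 a b) (cst 0%E).
  apply/ae_eq_integral_abs => //; first exact: measurable_int ib.
  transitivity (\int[mu]_x (bump 0 a b x)%:E)%E.
    by apply: eq_integral => x _ /=; rewrite ger0_norm// bump_ge0.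
  by rewrite -[LHS]fineK ?integrable_fin_num//; congr EFin.
have : (mu `]a, b[ <= mu N)%E.
  apply: le_measure; rewrite ?inE//= => x xab; apply: subN => /= /(_ I) [].
  by apply/eqP; rewrite gt_eqF// bump_gt0.
by rewrite N0 lebesgue_measure_itv/= lte_fin ab -EFinB lee_fin subr_le0 leNgt ab.
Qed.

End Bumps.

Section TestFunctions.
Context {R : realType}.
Implicit Types (f z : R -> R).
Local Notation mu := (@lebesgue_measure R).

(** Admissible functions must have compact support, so the constant 1 is replaced by a plateau over
    [0, H]. Its height c is not normalized: only its positivity is needed, to divide by it. *)
Lemma cutoff_exists (H : R) : 0 <= H -> exists (z z' : R -> R) (c : R),
  [/\ smooth_on [set: R] z, forall x : R, is_derive x (1 : R) z (z' x),
      smooth_on [set: R] z' /\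
      (forall t, t \notin `]- 2, H + 2[ -> z t = 0 /\ z' t = 0),
      0 < c & forall t, t \in `[0, H] -> z t = c /\ z' t = 0].
Proof.
move=> H0.
have ab1 : (- 2 : R) < - 1 by lra.
have ab2 : H + 1 < H + 2 by lra.
have h1 : - 2 <= H + 1 by lra.
have h2 : - 1 <= H + 2 by lra.
have h3 : 0 < - 1 - (- 2) :> R by lra.
have h4 : - 1 <= H + 1 by lra.
have J1 := bump_integral_gt0 ab1; have J2 := bump_integral_gt0 ab2.
set b1 := bump 0 (- 2) (- 1) in J1; set b2 := bump 0 (H + 1) (H + 2) in J2.
set j1 := Rintegral _ _ _ in J1; set j2 := Rintegral _ _ _ in J2.
(* One bump on each side of the plateau; each is weighted by the integral of the other, with
   opposite signs, so that the total integral is 0 and the primitive has compact support. *)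
pose z' x := j2 * b1 x + (- j1) * b2 x.
have sz' : smooth_on [set: R] z'.
  move=> k; apply: CkD; apply: CkM; try exact: Ck_cst; exact: smooth_bump.
have int a b : a < b -> mu.-integrable setT (EFin \o bump 0 a b).
  move=> ab; apply: (@continuous_supp_integrable _ _ a b).
    exact/smooth_continuous/smooth_bump.
  move=> t tab; apply: bump_out; apply: contra tab; exact: subset_itv_oo_cc.
have z'0 t : t \notin `]- 2, H + 2[ -> z' t = 0.
  rewrite in_itv/= negb_and -!leNgt => tH.
  rewrite /z' /b1 /b2 !bump_out ?mulr0 ?addr0// in_itv/= negb_and -!leNgt.
    by case/orP: tH => [/le_trans ->//|->]; rewrite ?orbT.
  by case/orP: tH => [->//|/(le_trans h2) ->]; rewrite orbT.
have [||z [sz dz z0]] := smooth_primitive _ sz' z'0.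
- by rewrite (le_trans h1)// lerD2l ler1n.
- rewrite /z' RintegralD//; last 2 first.
  + exact: (integrableZl measurableT _ (int _ _ ab1)).
  + exact: (integrableZl measurableT _ (int _ _ ab2)).
  rewrite RintegralZl//; last exact: int.
  rewrite RintegralZl//; last exact: int.
  by rewrite -/j1 -/j2; ring.
have dzc x : continuous_at x z.
  by apply/differentiable_continuous/derivable1_diffP; have := dz x.
exists z, z', (z (- 1)); split => //.
- by split => // t tH; split; [exact: z0|exact: z'0].
- have [c c12 /eqP] := MVT ab1 (fun x _ => dz x) (continuous_subspaceT dzc).
  have -> : z (- 2) = 0 by rewrite z0// in_itv/= negb_and -leNgt lexx.
  rewrite subr0 => /eqP ->; rewrite mulr_gt0//.
  rewrite /z' /b2 bump_out ?mulr0 ?addr0.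
    by rewrite mulr_gt0// bump_gt0.
  rewrite in_itv/= negb_and -!leNgt; move: c12; rewrite in_itv/= => /andP[_ c1].
  by rewrite (le_trans (ltW c1) h4).
- move=> t; rewrite in_itv/= => /andP[t0 tH].
  have z'0t x : x \in `]- 1, t[ -> z' x = 0.
    rewrite in_itv/= => /andP[x1 xt].
    rewrite /z' /b1 /b2 !bump_out ?mulr0 ?addr0// in_itv/= negb_and -!leNgt.
      by rewrite (le_trans (ltW xt))// (le_trans tH)// lerDl.
    by rewrite (ltW x1) orbT.
  have t1 : - 1 < t by rewrite (lt_le_trans _ t0)// oppr_lt0.
  split.
    have [c c12 /eqP] := MVT t1 (fun x _ => dz x) (continuous_subspaceT dzc).
    by rewrite z'0t// mul0r subr_eq0 => /eqP.
  rewrite /z' /b1 /b2 !bump_out ?mulr0 ?addr0// in_itv/= negb_and -!leNgt.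
    by rewrite (le_trans tH)// lerDl.
  by rewrite (ltW t1) orbT.
Qed.

Lemma compact_box (a1 b1 a2 b2 a3 b3 : R) :
  compact (`[a1, b1] `*` `[a2, b2] `*` `[a3, b3]).
Proof. by apply: compact_setX; [apply: compact_setX|]; exact: segment_compact. Qed.

Lemma test_fun_box (A : set (R * R * R)) (t1 t2 z : R -> R) a1 b1 a2 b2 a3 b3 :
  smooth_on [set: R] t1 -> smooth_on [set: R] t2 -> smooth_on [set: R] z ->
  (forall t, t \notin `]a1, b1[ -> t1 t = 0) ->
  (forall t, t \notin `]a2, b2[ -> t2 t = 0) ->
  (forall t, t \notin `]a3, b3[ -> z t = 0) ->
  `[a1, b1] `*` `[a2, b2] `*` `[a3, b3] `<=` A ->
  test_fun A (fun y => t1 y.1.1 * t2 y.1.2 * z y.2).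
Proof.
move=> s1 s2 s3 o1 o2 o3 BA.
have sub : closure [set y : R * R * R | t1 y.1.1 * t2 y.1.2 * z y.2 != 0] `<=`
    `[a1, b1] `*` `[a2, b2] `*` `[a3, b3].
  have cB := compact_closed (@norm_hausdorff _ _) (@compact_box a1 b1 a2 b2 a3 b3).
  rewrite [X in _ `<=` X](closure_id _).1//.
  apply: closure_subset => -[[x1 x2] x3] /= y0.
  have [n1|] := boolP (x1 \in `]a1, b1[); last first.
    by move=> /o1 E; rewrite E !mul0r eqxx in y0.
  have [n2|] := boolP (x2 \in `]a2, b2[); last first.
    by move=> /o2 E; rewrite E mulr0 mul0r eqxx in y0.
  have [n3|] := boolP (x3 \in `]a3, b3[); last first.
    by move=> /o3 E; rewrite E mulr0 eqxx in y0.
  by split; [split|]; apply: subset_itv_oo_cc.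
split; last exact: subset_trans sub BA.
- apply: smooth_onM; first apply: smooth_onM.
  + rewrite (_ : (fun y => _) = (fun y : R * R * R => t1 (y.1.1 + 0))).
      apply: (@smooth_on_comp_affine _ _ _ (fun y : R * R * R => y.1.1)) => //.
      by move=> y; apply: (@continuous_comp _ _ _ fst fst); exact: cvg_fst.
    by apply/funext => y; rewrite addr0.
  + rewrite (_ : (fun y => _) = (fun y : R * R * R => t2 (y.1.2 + 0))).
      apply: (@smooth_on_comp_affine _ _ _ (fun y : R * R * R => y.1.2)) => //.
      by move=> y; apply: (@continuous_comp _ _ _ fst snd); [exact: cvg_fst|exact: cvg_snd].
    by apply/funext => y; rewrite addr0.
  + rewrite (_ : (fun y => _) = (fun y : R * R * R => z (y.2 + 0))).
      apply: (@smooth_on_comp_affine _ _ _ (fun y : R * R * R => y.2)) => //.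
      by move=> y; exact: cvg_snd.
    by apply/funext => y; rewrite addr0.
- apply: subclosed_compact sub; first exact: closed_closure.
  exact: compact_box.
Qed.

Lemma derive_e3 (t1 t2 z z' : R -> R) (y : R * R * R) :
  (forall x : R, is_derive x (1 : R) z (z' x)) ->
  'D_e3 (fun y => t1 y.1.1 * t2 y.1.2 * z y.2) y = t1 y.1.1 * t2 y.1.2 * z' y.2.
Proof.
move=> dz; pose c := t1 y.1.1 * t2 y.1.2.
have H : is_derive y.2 (1 : R) (fun x => c * z x) (c * z' y.2).
  by have := dz y.2 => ?; exact: is_deriveZ.
rewrite -[RHS]/(c * _) -[RHS](@derive_val _ _ _ _ _ _ _ H) /derive.
set F := (fun h : R => _); set G := (fun h : R => _).
suff -> : F = G by [].
apply/funext => h; rewrite /F /G.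
have E1 : (h *: e3 + y).1.1 = y.1.1 by rewrite -[LHS]/(h * 0 + y.1.1) mulr0 add0r.
have E2 : (h *: e3 + y).1.2 = y.1.2 by rewrite -[LHS]/(h * 0 + y.1.2) mulr0 add0r.
transitivity (h^-1 *: (t1 (h *: e3 + y).1.1 * t2 (h *: e3 + y).1.2
  * z (h *: e3 + y).2 - t1 y.1.1 * t2 y.1.2 * z y.2)); first by [].
by rewrite E1 E2.
Qed.

End TestFunctions.

(** * Fundamental lemma of the calculus of variations *)

Section Determining.
Context {R : realType}.

(** Formulated for a family of sets so that the property can be passed by Fubini from the line to
    the plane and then to space. *)
Definition determining {d} {T : measurableType d} (mu : {measure set T -> \bar R})
    {I : Type} (C : I -> set T) :=
  forall F : T -> R, mu.-integrable setT (EFin \o F) ->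
    (forall i, (\int[mu]_(x in C i) (F x)%:E = 0)%E) ->
    {ae mu, forall x, F x = 0}.

(** Dynkin's pi-lambda argument, carried out inside B: complements are taken relative to B, whose
    integral vanishes because B belongs to the pi-system. *)
Lemma ae_eq0_pi_system {d} {T : measurableType d} (mu : {measure set T -> \bar R})
    (G : set (set T)) (B : set T) (F : T -> R) :
  measurable = <<s G>> -> setI_closed G -> G B ->
  mu.-integrable setT (EFin \o F) ->
  (forall A, G A -> (\int[mu]_(x in A) (F x)%:E = 0)%E) ->
  {ae mu, forall x, B x -> F x = 0}.
Proof.
move=> mG GI GB intF F0.
have GM A : G A -> measurable A by rewrite mG; exact: sub_sigma_algebra.
have mB : measurable B by exact: GM.
have intS A : measurable A -> mu.-integrable A (EFin \o F).
  by move=> mA; exact: integrableS intF.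
have key S : <<s G>> S -> (\int[mu]_(x in S `&` B) (F x)%:E = 0)%E.
  move: S; apply: (@dynkin_induction _ T G) => //.
  - by rewrite setTI; exact: F0.
  - by move=> A GA; apply: F0; exact: GI.
  - move=> S mS S0.
    have : (\int[mu]_(x in (S `&` B) `|` (~` S `&` B)) (F x)%:E = 0)%E.
      by rewrite -setIUl setUv setTI; exact: F0.
    rewrite integral_setU.
    + by rewrite S0 add0e.
    + exact: measurableI.
    + by apply: measurableI => //; exact: measurableC.
    + apply: measurable_int (intS _ _); apply: measurableU; apply: measurableI => //.
      exact: measurableC.
    + by rewrite disj_set2E setIACA setICr set0I eqxx.
  - move=> A mA tA A0; rewrite setI_bigcupl integral_bigcup.
    + by apply: eseries0 => k _ _; exact: A0.
    + by apply/trivIsetP => i j _ _ ij; rewrite setIACA (trivIsetP.1 tA) ?set0I.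
    + by move=> k; exact: measurableI.
    + by apply: intS; apply: bigcup_measurable => k _; exact: measurableI.
have : ae_eq mu B (EFin \o F) (cst 0%E).
  apply: integral_ae_eq => //; first exact: intS.
  move=> E EB mE; rewrite integral0 -(setIidl EB); apply: key.
  by rewrite -mG.
by apply: filterS => x /= H /H [].
Qed.

Definition ratitv (p : rat * rat) : set (measurableTypeR R) := `]ratr p.1, ratr p.2[%classic.

(** Indexing by natural numbers, through the encoding of pairs of rationals, serves the exchange of
    [ae] with a countable quantifier; numbers that encode no pair give the empty set. *)
Definition ratitvs (n : nat) : set (measurableTypeR R) :=
  if unpickle n is Some p then ratitv p else set0.

Lemma ratitvsP p : exists n, ratitvs n = ratitv p.
Proof. by exists (pickle p); rewrite /ratitvs pickleK. Qed.

Lemma ratitvs_measurable n : measurable (ratitvs n).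
Proof. by rewrite /ratitvs; case: unpickle => // p; exact: measurable_itv. Qed.

Lemma ratitv_nbhs (x a b : R) : a < x < b ->
  exists p, [/\ a < ratr p.1, ratr p.2 < b & ratitv p x].
Proof.
move=> /andP[ax xb].
have [q /itvP qx] := rat_in_itvoo ax; have [s /itvP sx] := rat_in_itvoo xb.
by exists (q, s); split; rewrite /ratitv/= ?in_itv/= ?qx ?sx.
Qed.

Lemma measurable_ratitvs : @measurable _ (measurableTypeR R) = <<s range ratitv >>.
Proof.
transitivity <<s @RGenOpens.G R>>; first exact: RGenOpens.measurableE.
apply/seteqP; split; apply: smallest_sub; try exact: smallest_sigma_algebra.
  move=> _ [x [y ->]].
  (* An open interval is the countable union of the rational intervals that it contains. *)
  have -> : `]x, y[%classic = \bigcup_n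
     (if `[< ratitvs n `<=` `]x, y[ >] then ratitvs n else set0).
    apply/seteqP; split => z /=.
      rewrite in_itv/= => /ratitv_nbhs[p [xp py pz]].
      have [n nE] := ratitvsP p; exists n => //.
      rewrite nE ifT//; apply/asboolP => t; rewrite /ratitv/= !in_itv/= => /andP[pt tp].
      by rewrite (lt_trans xp pt) (lt_trans tp py).
    by move=> [n _]; case: ifPn => // /asboolP; apply.
  apply: sigma_algebra_bigcup => n. case: ifPn => _; last exact: sigma_algebra0.
  rewrite /ratitvs; case: unpickle => [p|]; last exact: sigma_algebra0.
  by apply: sub_sigma_algebra; exists p.
by move=> _ [p _ <-]; apply: sub_sigma_algebra; exists (ratr p.1), (ratr p.2).
Qed.

Lemma ratitvI p q :
  ratitv p `&` ratitv q = ratitv (Num.max p.1 q.1, Num.min p.2 q.2).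
Proof.
have hr (a b : rat) : a <= b -> (ratr a : R) <= ratr b by rewrite ler_rat.
have hmax (a b : rat) : ratr (Num.max a b) = Num.max (ratr a) (ratr b) :> R.
  by case: (leP a b) => [/hr/max_idPr ->|/ltW/hr/max_idPl ->].
have hmin (a b : rat) : ratr (Num.min a b) = Num.min (ratr a) (ratr b) :> R.
  by case: (leP a b) => [/hr/min_idPl ->|/ltW/hr/min_idPr ->].
apply/seteqP; split => x; rewrite /ratitv/= !in_itv/= hmax hmin gt_max lt_min.
  by move=> [/andP[-> ->] /andP[-> ->]].
by move=> /andP[/andP[-> ->] /andP[-> ->]].
Qed.

Lemma determining_ratitvs : determining (@lebesgue_measure R) ratitvs.
Proof.
move=> F intF F0.
(* The whole line is not a rational interval, so the pi-system argument is run on each ]-n, n[ and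
   the countably many null sets are joined. *)
have key (n : nat) : {ae @lebesgue_measure R, forall x,
    ratitv (- n%:R, n%:R) x -> F x = 0}.
  apply: (ae_eq0_pi_system measurable_ratitvs) => //.
  - by move=> _ _ [p _ <-] [q _ <-]; rewrite ratitvI; eexists.
  - by move=> _ [p _ <-]; have [m <-] := ratitvsP p; exact: F0.
have := ae_foralln key.
apply: filterS => x H; apply: (H (Num.bound `|x|)).
rewrite /ratitv/= in_itv/= rmorphN/= ratr_nat -ltr_norml.
exact: archi_boundP.
Qed.

End Determining.

Section ProductDetermining.
Context {R : realType} {d1 d2} {T1 : measurableType d1} {T2 : measurableType d2}.
Variables (m1 : {sigma_finite_measure set T1 -> \bar R})
  (m2 : {sigma_finite_measure set T2 -> \bar R}).

(* The second family is countable so that almost every x works for all its sets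
   simultaneously. *)
Lemma determining_prod {I} (C1 : I -> set T1) (C2 : nat -> set T2) :
  (forall i, measurable (C1 i)) -> (forall n, measurable (C2 n)) ->
  determining m1 C1 -> determining m2 C2 ->
  determining (m1 \x m2)%E (fun i : I * nat => C1 i.1 `*` C2 i.2).
Proof.
move=> mC1 mC2 D1 D2 F intF F0.
pose Fn n := F \_ (setT `*` C2 n).
have mn n : measurable (setT `*` C2 n : set (T1 * T2)) by exact: measurableX.
have intFn n : (m1 \x m2)%E.-integrable setT (EFin \o Fn n).
  rewrite -restrict_EFin; apply: (integrable_mkcond _ _).1 => //.
  exact: integrableS intF.
pose G n x := (\int[m2]_(y in C2 n) (F (x, y))%:E)%E.
have GE n : G n = fubini_F m2 (EFin \o Fn n).
  apply/funext => x; rewrite /G /fubini_F [LHS]integral_mkcond.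
  apply: eq_integral => y _; rewrite /Fn !patchE/=.
  by rewrite /patch in_setX in_setT/=; case: ifPn.
have intG n : m1.-integrable setT (G n).
  by rewrite GE; exact: integrable_fubini_F (intFn n).
have G0 n : {ae m1, forall x, G n x = 0%E}.
  have fG := integrable_ae measurableT (intG n).
  have : {ae m1, forall x, fine (G n x) = 0}.
    apply: D1.
      apply: le_integrable (intG n) => //.
        by apply/measurable_EFinP/measurableT_comp => //; exact: measurable_int (intG n).
      by move=> x _ /=; case: (G n x) => //=; rewrite ?normr0 leey.
    move=> i; transitivity (\int[m1]_(x in C1 i) G n x)%E.
      apply: ae_eq_integral_any; apply: filterS fG => x H _; rewrite fineK//.
      exact: H.
    transitivity (\int[m1 \x m2]_(z in C1 i `*` C2 n) (F z)%:E)%E; last exact: F0 (i, n).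
    rewrite [LHS]integral_mkcond [RHS]integral_mkcond -integral12_prod_meas1; last first.
      apply: (integrable_mkcond _ _).1; first exact: measurableX.
      by apply: integrableS intF => //; exact: measurableX.
    apply: eq_integral => x _; rewrite /fubini_F patchE; case: ifPn => xi.
      rewrite /G [LHS]integral_mkcond; apply: eq_integral => y _; rewrite !patchE.
      by rewrite in_setX/= xi.
    by rewrite integral0_eq// => y _; rewrite patchE in_setX/= (negbTE xi).
  by move=> fG0; apply: filterS2 fG fG0 => x Gx fx; rewrite -[LHS]fineK ?fx//; exact: Gx.
have {}G0 := ae_foralln G0.
have sF := ae_integrable1 intF.
(* Almost every slice of F vanishes almost everywhere, hence |F| has zero double integral by
   Tonelli. *)
have F0x : {ae m1, forall x, \int[m2]_y `|(F (x, y))%:E| = 0}%E.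
  apply: filterS2 G0 sF => x Gx Fx.
  apply/ae_eq_integral_abs => //; first exact: measurable_int Fx.
  have := D2 (fun y => F (x, y)) Fx Gx.
  by apply: filterS => y -> _.
have : ae_eq (m1 \x m2)%E setT (EFin \o F) (cst 0%E).
  apply/ae_eq_integral_abs => //; first exact: measurable_int intF.
  rewrite fubini_tonelli1//; last first.
    by apply: measurableT_comp => //; exact: measurable_int intF.
  rewrite -[RHS](integral0 m1 setT).
  by apply: ae_eq_integral_any; apply: filterS F0x => x H _.
by apply: filterS => x /= H; case: (H Logic.I).
Qed.

End ProductDetermining.

Section Fundamental.
Context {R : realType}.
Local Notation mu := (@lebesgue_measure R).

Definition cbox (a b : R * R * R) : set (R * R * R) :=
  `[a.1.1, b.1.1] `*` `[a.1.2, b.1.2] `*` `[a.2, b.2].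

Definition obox (a b : R * R * R) : set (R * R * R) :=
  `]a.1.1, b.1.1[ `*` `]a.1.2, b.1.2[ `*` `]a.2, b.2[.

Definition bump3 (n : nat) (a b y : R * R * R) : R :=
  bump n a.1.1 b.1.1 y.1.1 * bump n a.1.2 b.1.2 y.1.2 * bump n a.2 b.2 y.2.

Definition lt3 (a b : R * R * R) := [/\ a.1.1 < b.1.1, a.1.2 < b.1.2 & a.2 < b.2].

Definition rat3 (p : rat * rat * rat) : R * R * R :=
  (ratr p.1.1, ratr p.1.2, ratr p.2).

Local Notation T3 := (measurableTypeR R * measurableTypeR R * measurableTypeR R)%type.

Lemma determining_leb3 : determining (@leb3 R)
  (fun i : nat * nat * nat => ratitvs i.1.1 `*` ratitvs i.1.2 `*` ratitvs i.2).
Proof.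
have D2 : determining (@leb2 R) (fun i : nat * nat => ratitvs i.1 `*` ratitvs i.2).
  exact: (@determining_prod R _ _ (measurableTypeR R) (measurableTypeR R) mu mu _ _ _
    ratitvs_measurable ratitvs_measurable determining_ratitvs determining_ratitvs).
apply: (@determining_prod R _ _ (measurableTypeR R * measurableTypeR R)%type
  (measurableTypeR R) (@leb2 R) mu _ _ _ _ ratitvs_measurable D2 determining_ratitvs).
by move=> i; apply: measurableX; exact: ratitvs_measurable.
Qed.

Lemma measurable_cbox a b : measurable (cbox a b : set T3).
Proof. by apply: measurableX; [apply: measurableX|]; exact: measurable_itv. Qed.

Lemma measurable_obox a b : measurable (obox a b : set T3).
Proof. by apply: measurableX; [apply: measurableX|]; exact: measurable_itv. Qed.

Lemma obox_sub_cbox a b : obox a b `<=` cbox a b.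
Proof.
by move=> y [[/= y1 y2] y3]; split; [split|]; exact: subset_itv_oo_cc.
Qed.

Lemma open_rat_box (A : set (R * R * R)) y : open A -> A y ->
  exists p q, [/\ cbox (rat3 p) (rat3 q) `<=` A & obox (rat3 p) (rat3 q) y].
Proof.
rewrite openE => /[apply] /nbhs_ballP[e /= e0 eA].
have near_itv (x : R) : x - e < x < x + e by rewrite ltrDl e0 ltrBlDr ltrDl e0.
have [p1 [pa1 pb1 py1]] := ratitv_nbhs (near_itv y.1.1).
have [p2 [pa2 pb2 py2]] := ratitv_nbhs (near_itv y.1.2).
have [p3 [pa3 pb3 py3]] := ratitv_nbhs (near_itv y.2).
exists (p1.1, p2.1, p3.1), (p1.2, p2.2, p3.2); split; last by split; [split|].
have key (x z u v : R) : x - e < u -> v < x + e -> z \in `[u, v] -> ball x e z.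
  move=> xu vx; rewrite in_itv/= => /andP[uz zv].
  rewrite /ball/= distrC ltr_distl.
  by rewrite (lt_le_trans xu uz) (le_lt_trans zv vx).
move=> z [[/= z1 z2] z3]; apply: eA; split; [split|].
- exact: key z1.
- exact: key z2.
- exact: key z3.
Qed.

Lemma open_measurable3 (A : set (R * R * R)) : open A -> measurable (A : set T3).
Proof.
move=> oA.
pose B (n : nat) : set T3 :=
  if (unpickle n : option (rat * rat * rat * (rat * rat * rat))) is Some pq then
    if `[< cbox (rat3 pq.1) (rat3 pq.2) `<=` A >]
    then obox (rat3 pq.1) (rat3 pq.2) else set0
  else set0.
suff -> : A = \bigcup_n B n.
  apply: bigcupT_measurable => n; rewrite /B; case: unpickle => // pq.
  by case: ifPn => // _; exact: measurable_obox.
apply/seteqP; split => y.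
  move=> /(open_rat_box oA)[p [q [cA oy]]].
  have [n nE] : exists n, unpickle n = Some (p, q).
    by exists (pickle (p, q)); exact: pickleK.
  by exists n => //; rewrite /B nE ifT//; exact/asboolP.
move=> [n _]; rewrite /B; case: unpickle => // pq.
by case: ifPn => // /asboolP cA /obox_sub_cbox; exact: cA.
Qed.

Lemma measurable_bump n (a b : R) : measurable_fun setT (bump n a b : measurableTypeR R -> _).
Proof.
have H : continuous (bump n a b) by apply: smooth_continuous; exact: smooth_bump.
exact: continuous_measurable_fun.
Qed.

Lemma measurable_bump3 n a b : measurable_fun setT (bump3 n a b : T3 -> R).
Proof.
apply: measurable_funM; [apply: measurable_funM|].
- by apply: (measurableT_comp (measurable_bump _ _ _)); exact: measurableT_comp.
- by apply: (measurableT_comp (measurable_bump _ _ _)); exact: measurableT_comp.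
- exact: (measurableT_comp (measurable_bump _ _ _)).
Qed.

Lemma bump3_ge0 n a b y : 0 <= bump3 n a b y.
Proof. by apply: mulr_ge0; [apply: mulr_ge0|]; exact: bump_ge0. Qed.

Lemma bump3_le1 n a b y : bump3 n a b y <= 1.
Proof.
rewrite -[leRHS]mulr1; apply: ler_pM; rewrite ?bump_ge0 ?bump_le1//.
  by apply: mulr_ge0; exact: bump_ge0.
by rewrite -[leRHS]mulr1; apply: ler_pM; rewrite ?bump_ge0 ?bump_le1.
Qed.

Lemma bump3_cvg a b y : bump3 n a b y @[n --> \oo] --> (\1_(obox a b) y : R).
Proof.
have -> : \1_(obox a b) y = \1_(`]a.1.1, b.1.1[%classic : set R) y.1.1
    * \1_(`]a.1.2, b.1.2[%classic : set R) y.1.2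
    * \1_(`]a.2, b.2[%classic : set R) y.2 :> R.
  by rewrite !indicE !in_setX -!natrM !mulnb.
by apply: cvgM; [apply: cvgM|]; exact: bump_cvg.
Qed.

(** Dominated convergence: the bumps tend to the indicator of the open box and stay between 0 and 1,
    so |F| dominates. *)
Lemma integral_obox0 (F : R * R * R -> R) a b :
  (@leb3 R).-integrable (cbox a b) (EFin \o F) ->
  (forall n, \int[leb3]_(y in cbox a b) (F y * bump3 n a b y) = 0) ->
  (\int[leb3]_(y in obox a b) (F y)%:E = 0)%E.
Proof.
move=> iF F0.
have mF := measurable_int _ iF.
pose f_ n (y : T3) := (F y * bump3 n a b y)%:E.
pose f (y : T3) := (F y * \1_(obox a b) y)%:E.
have mf_ n : measurable_fun (cbox a b) (f_ n).
  apply/measurable_EFinP/measurable_funM; first exact/measurable_EFinP.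
  exact: measurable_funTS (measurable_bump3 _ _ _).
have domf n (y : T3) : (`|f_ n y| <= `|(F y)%:E|)%E.
  by rewrite /f_ /= lee_fin normrM ler_piMr// ger0_norm ?bump3_ge0 ?bump3_le1.
have [] := @dominated_convergence _ _ _ (@leb3 R) (cbox a b) (measurable_cbox a b)
   f_ f (abse \o (EFin \o F)).
- exact: mf_.
- apply/measurable_EFinP/measurable_funM; first exact/measurable_EFinP.
  by apply: measurable_funTS; exact: measurable_indic (measurable_obox a b).
- apply: aeW => y _; apply: cvg_EFin; first exact: nearW.
  by apply: cvgM; [exact: cvg_cst|exact: bump3_cvg].
- exact: integrable_abse.
- by apply: aeW => y n _; exact: domf.
move=> _ _.
have -> : (fun n => (\int[leb3]_(x in cbox a b) f_ n x)%E) = (fun=> 0%E).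
  apply/funext => n; rewrite -[LHS]fineK; first by rewrite [X in X%:E](F0 n).
  apply: integrable_fin_num; first exact: measurable_cbox.
  apply: le_integrable iF; [exact: measurable_cbox|exact: mf_|].
  by move=> y _; exact: domf.
move=> /(cvg_lim (@ereal_hausdorff R)); rewrite lim_cst//.
move=> f0; rewrite f0 [in LHS]integral_mkcond [in RHS]integral_mkcond.
apply: eq_integral => y _; rewrite /patch /f indicE.
case: ifPn => yo; last by rewrite mulr0; case: ifP.
by rewrite mulr1 ifT//; apply/mem_set/obox_sub_cbox/set_mem.
Qed.

(** On one rational box whose closed version lies in A, the previous limit gives zero integrals over
    all rational sub-boxes, which determine F there. Countably many such boxes cover A, so local
    integrability on closed boxes suffices. *)
Lemma ae_eq0_test (A : set (R * R * R)) (F : R * R * R -> R) : open A ->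
  (forall a b, lt3 a b -> cbox a b `<=` A ->
    (@leb3 R).-integrable (cbox a b) (EFin \o F)) ->
  (forall n a b, lt3 a b -> cbox a b `<=` A ->
    \int[leb3]_(y in cbox a b) (F y * bump3 n a b y) = 0) ->
  {ae @leb3 R, forall y, A y -> F y = 0}.
Proof.
move=> oA iF F0.
have F0o a b : lt3 a b -> cbox a b `<=` A -> (\int[leb3]_(y in obox a b) (F y)%:E = 0)%E.
  by move=> ab abA; apply: integral_obox0 => [|n]; [exact: iF|exact: F0].
have key (p q : rat * rat * rat) : {ae @leb3 R, forall y,
    cbox (rat3 p) (rat3 q) `<=` A -> obox (rat3 p) (rat3 q) y -> F y = 0}.
  have [pqA|pqA] := pselect (cbox (rat3 p) (rat3 q) `<=` A); last first.
    by apply: aeW => y /pqA.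
  set Q := obox (rat3 p) (rat3 q).
  have mQ : measurable (Q : set T3) by exact: measurable_obox.
  have [pq|pq] := pselect (lt3 (rat3 p) (rat3 q)); last first.
    apply: aeW => y _ [[/= y1 y2] y3]; exfalso; apply: pq.
    move: y1 y2 y3; rewrite !in_itv/= => /andP[y1 y1'] /andP[y2 y2'] /andP[y3 y3'].
    by split; [exact: lt_trans y1'|exact: lt_trans y2'|exact: lt_trans y3'].
  have : {ae @leb3 R, forall y, (F \_ Q) y = 0}.
    apply: determining_leb3.
      rewrite -restrict_EFin; apply: (integrable_mkcond _ _).1 => //.
      apply: integrableS (iF _ _ pq pqA) => //; first exact: measurable_cbox.
      exact: obox_sub_cbox.
    move=> [[n1 n2] n3] /=.
    set C := _ `*` _.
    have -> : (\int[leb3]_(y in C) ((F \_ Q) y)%:E = \int[leb3]_(y in C `&` Q) (F y)%:E)%E.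
      by rewrite [RHS]integral_mkcondr restrict_EFin.
    rewrite {}/C /ratitvs.
    case: unpickle => [s1|]; last by rewrite !set0X set0I integral_set0.
    case: unpickle => [s2|]; last by rewrite setX0 set0X set0I integral_set0.
    case: unpickle => [s3|]; last by rewrite setX0 set0I integral_set0.
    (* The intersection of two rational boxes is a rational box, possibly degenerate. *)
    pose a := (Num.max s1.1 p.1.1, Num.max s2.1 p.1.2, Num.max s3.1 p.2).
    pose b := (Num.min s1.2 q.1.1, Num.min s2.2 q.1.2, Num.min s3.2 q.2).
    have -> : (ratitv s1 `*` ratitv s2 `*` ratitv s3) `&` Q = obox (rat3 a) (rat3 b).
      rewrite /Q /obox -!setXI.
      rewrite -[`]_, _[%classic]/(ratitv (p.1.1, q.1.1)).
      rewrite -[`](rat3 p).1.2, _[%classic]/(ratitv (p.1.2, q.1.2)).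
      rewrite -[`](rat3 p).2, _[%classic]/(ratitv (p.2, q.2)).
      by rewrite !ratitvI.
    have [ab|ab] := pselect (lt3 (rat3 a) (rat3 b)); last first.
      rewrite (_ : obox _ _ = set0) ?integral_set0//.
      rewrite -subset0 => y [[/= y1 y2] y3]; apply: ab.
      move: y1 y2 y3; rewrite !in_itv/= => /andP[y1 y1'] /andP[y2 y2'] /andP[y3 y3'].
      by split; [exact: lt_trans y1'|exact: lt_trans y2'|exact: lt_trans y3'].
    apply: F0o => //; apply: subset_trans pqA => y [[/= y1 y2] y3].
    move: y1 y2 y3; rewrite !in_itv/= => /andP[y1 y1'] /andP[y2 y2'] /andP[y3 y3'].
    split; [split|]; rewrite /= in_itv/=; apply/andP; split.
    + by apply: le_trans y1; rewrite ler_rat le_max lexx orbT.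
    + by apply: (le_trans y1'); rewrite ler_rat ge_min lexx orbT.
    + by apply: le_trans y2; rewrite ler_rat le_max lexx orbT.
    + by apply: (le_trans y2'); rewrite ler_rat ge_min lexx orbT.
    + by apply: le_trans y3; rewrite ler_rat le_max lexx orbT.
    + by apply: (le_trans y3'); rewrite ler_rat ge_min lexx orbT.
  apply: aeS => y + _ Qy; rewrite /patch ifT//; exact/mem_set.
have H : {ae @leb3 R, forall y, forall n : nat,
    if (unpickle n : option (rat * rat * rat * (rat * rat * rat))) is Some pq then
    (cbox (rat3 pq.1) (rat3 pq.2) `<=` A -> obox (rat3 pq.1) (rat3 pq.2) y -> F y = 0)
    else True}.
  apply: ae_foralln => n; case: unpickle => [pq|]; first exact: key.
  exact: aeW.
apply: aeS H => y H /(open_rat_box oA)[p [q [cA oy]]].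
have [n nE] : exists n, unpickle n = Some (p, q).
  by exists (pickle (p, q)); exact: pickleK.
by have := H n; rewrite nE; exact.
Qed.

End Fundamental.

(** * Fubini and reflection *)

Section IntegralTools.
Context {d} {T : measurableType d} {R : realType}.
Variable mu : {measure set T -> \bar R}.
Implicit Types f g : T -> R.

Lemma integrable_bounded_mulr f g (C : R) : measurable_fun setT g ->
  (forall x, `|g x| <= C) -> mu.-integrable setT (EFin \o f) ->
  mu.-integrable setT (EFin \o (fun x => f x * g x)).
Proof.
move=> mg gC intf.
have mf : measurable_fun setT f by apply/measurable_EFinP; exact: measurable_int intf.
apply: (@le_integrable _ _ _ _ _ _ _ (fun x => (`|C|%:E * (f x)%:E)%E)) => //.
- by apply/measurable_EFinP; exact: measurable_funM.
- move=> x _; rewrite -EFinM lee_fin !normrM mulrC ler_wpM2r//.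
  by rewrite normr_id (le_trans (gC x)) ?ler_norm.
- exact: (integrableZl measurableT).
Qed.

Lemma integrable_cst_mulr f (C : R) : mu.-integrable setT (EFin \o f) ->
  mu.-integrable setT (EFin \o (fun x => C * f x)).
Proof. by move=> intf; exact: (integrableZl measurableT C intf). Qed.

Lemma integrable_add f g : mu.-integrable setT (EFin \o f) ->
  mu.-integrable setT (EFin \o g) -> mu.-integrable setT (EFin \o (fun x => f x + g x)).
Proof. by move=> intf intg; exact: (integrableD measurableT intf intg). Qed.

Lemma integrable_sub f g : mu.-integrable setT (EFin \o f) ->
  mu.-integrable setT (EFin \o g) -> mu.-integrable setT (EFin \o (fun x => f x - g x)).
Proof. by move=> intf intg; exact: (integrableB measurableT intf intg). Qed.

Lemma integrable_indic_fin (A : set T) : measurable A -> (mu A < +oo)%E ->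
  mu.-integrable setT (EFin \o (\1_A : T -> R)).
Proof.
move=> mA A_fin; apply/integrableP; split.
  by apply/measurable_EFinP; exact: measurable_indic.
rewrite (eq_integral (EFin \o (\1_A : T -> R))).
  by rewrite integral_indic// setIT.
by move=> x _ /=; rewrite ger0_norm.
Qed.

End IntegralTools.

Section FubiniReal.
Context {R : realType} {d1 d2} {T1 : measurableType d1} {T2 : measurableType d2}.
Variables (m1 : {sigma_finite_measure set T1 -> \bar R})
  (m2 : {sigma_finite_measure set T2 -> \bar R}).

Lemma Rintegral_fubini (f : T1 * T2 -> R) :
  (m1 \x m2)%E.-integrable setT (EFin \o f) ->
  \int[(m1 \x m2)%E]_z f z = \int[m1]_x \int[m2]_y f (x, y).
Proof.
move=> intf; rewrite /Rintegral -integral12_prod_meas1//; congr fine.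
have := integrable_ae measurableT (integrable_fubini_F intf).
move=> fF; apply: ae_eq_integral_any; apply: aeS fF => x fx _.
by rewrite fineK//; exact: fx.
Qed.

Lemma integrable_Rintegral2 (f : T1 * T2 -> R) :
  (m1 \x m2)%E.-integrable setT (EFin \o f) ->
  m1.-integrable setT (EFin \o (fun x => \int[m2]_y f (x, y))).
Proof.
move=> intf; have iF := integrable_fubini_F intf.
apply: le_integrable iF => //.
  apply/measurable_EFinP/measurableT_comp => //.
  exact: measurable_fubini_F intf.
move=> x _ /=; rewrite /Rintegral -/(fubini_F m2 (EFin \o f) x).
by case: fubini_F => //=; rewrite ?normr0 leey.
Qed.

Lemma ae_xsection (P : T1 * T2 -> Prop) :
  {ae (m1 \x m2)%E, forall z, P z} ->
  {ae m1, forall x, {ae m2, forall y, P (x, y)}}.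
Proof.
move=> [N [mN N0 PN]].
have : ae_eq m1 setT (m2 \o xsection N) (cst 0%E).
  apply/ae_eq_integral_abs => //; first exact: measurable_fun_xsection.
  rewrite -[RHS]N0; apply: eq_integral => x _.
  by rewrite gee0_abs.
apply: aeS => x /(_ Logic.I) Nx; exists (xsection N x); split => //.
  exact: measurable_xsection.
by move=> y /= nP; apply/xsectionP; exact: PN.
Qed.

End FubiniReal.

Section Reflection.
Context {R : realType}.
Local Notation mu := (@lebesgue_measure R).
Variable a : R.

Let refl (x : measurableTypeR R) : measurableTypeR R := a - x.

Let mrefl : measurable_fun setT refl.
Proof. exact: measurable_funB. Qed.

Let push := measure_function_pushforward__canonical__measure_function_Measure
  [the {measure set (measurableTypeR R) -> \bar R} of mu] mrefl.

(** Lebesgue measure is determined by half-open intervals, and the preimage of one under x |-> a - x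
    is half-open on the other side, with the same length. *)
Lemma lebesgue_measure_refl (A : set (measurableTypeR R)) : measurable A ->
  mu A = push A.
Proof.
apply: lebesgue_measure_unique => _ [[x y] _ <-] /=.
rewrite /pushforward (_ : _ @^-1` _ = `[a - y, a - x[%classic); last first.
  apply/seteqP; split => z; rewrite /refl /= !in_itv/= => /andP[h1 h2];
    by apply/andP; split; lra.
rewrite !lebesgue_measure_itv/= !lte_fin.
have -> : (a - y < a - x) = (x < y) by rewrite ltrD2l ltrN2.
by case: ifP => // _; rewrite -!EFinB; congr EFin; ring.
Qed.

Lemma ae_refl (P : R -> Prop) : {ae mu, forall x, P x} -> {ae mu, forall x, P (a - x)}.
Proof.
move=> [N [mN N0 PN]]; exists (refl @^-1` N); split.
- by rewrite -[X in measurable X]setTI; exact: mrefl.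
- by have := lebesgue_measure_refl mN; rewrite N0 => /esym.
- by move=> x /= nP; exact: PN.
Qed.

Lemma integrable_refl (f : R -> R) : mu.-integrable setT (EFin \o f) ->
  mu.-integrable setT (EFin \o (fun x => f (a - x))).
Proof.
move=> intf; have mf := measurable_int _ intf.
have mfr : measurable_fun setT ((EFin \o f) \o refl) by exact: measurableT_comp.
apply/integrableP; split; first exact: mfr.
have /integrableP[_ fi] := intf; apply: le_lt_trans fi.
have -> : (\int[mu]_x `|(EFin \o f) x| = \int[push]_x `|(EFin \o f) x|)%E.
  by apply: eq_measure_integral => A mA _; exact: lebesgue_measure_refl.
rewrite [leRHS]ge0_integral_pushforward//.
exact: measurableT_comp.
Qed.

Lemma Rintegral_refl (f : R -> R) : mu.-integrable setT (EFin \o f) ->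
  \int[mu]_x f (a - x) = \int[mu]_x f x.
Proof.
move=> intf; congr fine; apply: esym.
have -> : (\int[mu]_x (f x)%:E = \int[push]_x (f x)%:E)%E.
  by apply: eq_measure_integral => A mA _; exact: lebesgue_measure_refl.
rewrite (@integral_pushforward _ _ _ _ _ _ mrefl)//.
- exact: measurable_int intf.
- by rewrite preimage_setT; exact: integrable_refl.
Qed.

End Reflection.

Section Support.
Context {d} {T : measurableType d} {R : realType}.
Variable mu : {measure set T -> \bar R}.

Lemma Rintegral_supp (D : set T) (f : T -> R) : (forall x, ~ D x -> f x = 0) ->
  \int[mu]_(x in D) f x = \int[mu]_x f x.
Proof.
move=> f0; rewrite Rintegral_mkcond; congr Rintegral; apply/funext => x.
rewrite patchE; case: ifPn => // /negP xD; rewrite f0// => Dx.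
by apply: xD; exact/mem_set.
Qed.

Lemma integrable_patch (D : set T) (f : T -> R) : measurable D ->
  mu.-integrable D (EFin \o f) -> mu.-integrable setT (EFin \o (f \_ D)).
Proof.
move=> mD intf; rewrite -restrict_EFin.
by apply: (integrable_mkcond _ _).1.
Qed.

End Support.

Section Tensor.
Context {R : realType} {d1 d2} {T1 : measurableType d1} {T2 : measurableType d2}.
Variables (m1 : {sigma_finite_measure set T1 -> \bar R})
  (m2 : {sigma_finite_measure set T2 -> \bar R}).

Lemma integrable_tensor (f : T1 -> R) (g : T2 -> R) :
  m1.-integrable setT (EFin \o f) -> m2.-integrable setT (EFin \o g) ->
  (m1 \x m2)%E.-integrable setT (EFin \o (fun z => f z.1 * g z.2)).
Proof.
move=> intf intg.
have mf : measurable_fun setT f by apply/measurable_EFinP; exact: measurable_int intf.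
have mg : measurable_fun setT g by apply/measurable_EFinP; exact: measurable_int intg.
have mfg : measurable_fun setT (EFin \o (fun z : T1 * T2 => f z.1 * g z.2)).
  apply/measurable_EFinP; apply: measurable_funM.
    exact: (measurableT_comp mf).
  exact: (measurableT_comp mg).
apply/integrable12ltyP => //.
have E (x : T1) : (\int[m2]_y `|(f x * g y)%:E| =
    `|f x|%:E * \int[m2]_y `|(EFin \o g) y|)%E.
  rewrite -ge0_integralZl_EFin//.
    by apply: eq_integral => y _ /=; rewrite normrM.
  by apply: measurableT_comp => //; exact: measurable_int intg.
rewrite (eq_integral (fun x => (`|f x|%:E * \int[m2]_y `|(EFin \o g) y|)%E));
  last by move=> x _; exact: E.
have /integrableP[_ gi] := intg; have /integrableP[_ fi] := intf.
have g0 : (0 <= \int[m2]_y `|(EFin \o g) y|)%E by exact: integral_ge0.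
rewrite -(@fineK _ (\int[m2]_y _)%E); last by rewrite ge0_fin_numE.
under eq_integral do rewrite muleC.
rewrite ge0_integralZl_EFin//.
- by rewrite lte_mul_pinfty// lee_fin fine_ge0.
- by apply/measurable_EFinP; exact: measurableT_comp.
- exact: fine_ge0.
Qed.

Lemma Rintegral_tensor (f : T1 -> R) (g : T2 -> R) :
  m1.-integrable setT (EFin \o f) -> m2.-integrable setT (EFin \o g) ->
  \int[(m1 \x m2)%E]_z (f z.1 * g z.2) = \int[m1]_x f x * \int[m2]_y g y.
Proof.
move=> intf intg; rewrite Rintegral_fubini; last exact: integrable_tensor.
rewrite mulrC -RintegralZl//; congr Rintegral; apply/funext => x /=.
by rewrite RintegralZl// mulrC.
Qed.

End Tensor.

(** * The fundamental lemma in the plane *)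

Section PlaneTest.
Context {R : realType}.
Local Notation mu := (@lebesgue_measure R).
Local Notation T2 := (measurableTypeR R * measurableTypeR R)%type.
Local Notation T3 := (measurableTypeR R * measurableTypeR R * measurableTypeR R)%type.

Definition cbox2 (a b : R * R) : set (R * R) := `[a.1, b.1] `*` `[a.2, b.2].

Definition bump2 (n : nat) (a b x : R * R) : R :=
  bump n a.1 b.1 x.1 * bump n a.2 b.2 x.2.

Definition lt2 (a b : R * R) := a.1 < b.1 /\ a.2 < b.2.

Lemma measurable_cbox2 a b : measurable (cbox2 a b : set T2).
Proof. by apply: measurableX; exact: measurable_itv. Qed.

Lemma measurable_bump2 n a b : measurable_fun setT (bump2 n a b : T2 -> R).
Proof.
apply: measurable_funM; apply: (measurableT_comp (measurable_bump _ _ _)) => //;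
  exact: measurableT_comp.
Qed.

Lemma bump2_ge0 n a b x : 0 <= bump2 n a b x.
Proof. by apply: mulr_ge0; exact: bump_ge0. Qed.

Lemma bump2_le1 n a b x : bump2 n a b x <= 1.
Proof. by rewrite -[leRHS]mulr1; apply: ler_pM; rewrite ?bump_ge0 ?bump_le1. Qed.

Lemma normr_bump2_le1 n a b x : `|bump2 n a b x| <= 1.
Proof. by rewrite ger0_norm ?bump2_le1 ?bump2_ge0. Qed.

Lemma bump_out_cc n (a b t : R) : t \notin `[a, b] -> bump n a b t = 0.
Proof. by move=> tab; apply: bump_out; apply: contra tab; exact: subset_itv_oo_cc. Qed.

Lemma bump2_out n a b x : ~ cbox2 a b x -> bump2 n a b x = 0.
Proof.
move=> xab; rewrite /bump2.
have [x1|/bump_out_cc ->] := boolP (x.1 \in `[a.1, b.1]); last by rewrite mul0r.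
have [x2|/bump_out_cc ->] := boolP (x.2 \in `[a.2, b.2]); last by rewrite mulr0.
by exfalso; apply: xab; split.
Qed.

Lemma bump_integrable n (a b : R) : mu.-integrable setT (EFin \o bump n a b).
Proof.
apply: (@continuous_supp_integrable _ _ a b); last exact: bump_out_cc.
by apply: smooth_continuous; exact: smooth_bump.
Qed.

Lemma integrable_itv (a b : R) :
  mu.-integrable setT (EFin \o (\1_(`[a, b]) : measurableTypeR R -> R)).
Proof.
apply: integrable_indic_fin; first exact: measurable_itv.
apply: (@le_lt_trans _ _ (mu (`[a, b]%classic : set R))); first by [].
by rewrite lebesgue_measure_itv/=; case: ifP => // _; rewrite -EFinB ltry.
Qed.

Lemma open_cylinder (omega : set (R * R)) : open omega ->
  open [set y : R * R * R | omega y.1].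
Proof. by move=> oo; apply: (open_comp _ oo) => y _; exact: cvg_fst. Qed.

(** Deduced from the spatial version by viewing F as a function constant in y3: the test integral
    then factors into the planar one, which is 0, times the integral of a bump in y3. *)
Lemma ae_eq0_test2 (omega : set (R * R)) (F : R * R -> R) : open omega ->
  (forall a b, lt2 a b -> cbox2 a b `<=` omega ->
    (@leb2 R).-integrable (cbox2 a b) (EFin \o F)) ->
  (forall n a b, lt2 a b -> cbox2 a b `<=` omega ->
    \int[leb2]_(x in cbox2 a b) (F x * bump2 n a b x) = 0) ->
  {ae @leb2 R, forall x, omega x -> F x = 0}.
Proof.
move=> oo iF F0.
have box2 a b : lt3 a b -> cbox a b `<=` [set y | omega y.1] ->
    lt2 a.1 b.1 /\ cbox2 a.1 b.1 `<=` omega.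
  move=> [ab1 ab2 ab3] abo; split => // x xab; apply: (abo (x, a.2)); split => //=.
  by rewrite in_itv/= lexx ltW.
have tens a b : lt3 a b -> cbox a b `<=` [set y | omega y.1] ->
    (@leb2 R).-integrable setT (EFin \o (F \_ (cbox2 a.1 b.1))).
  move=> ab abo; have [ab1 abo1] := box2 _ _ ab abo.
  by apply: integrable_patch; [exact: measurable_cbox2|exact: iF].
have : {ae @leb3 R, forall y, [set y | omega y.1] y -> (F \o fst) y = 0}.
  apply: ae_eq0_test; first exact: open_cylinder.
    move=> a b ab abo.
    have H := integrable_tensor (tens _ _ ab abo) (integrable_itv a.2 b.2).
    have {}H := integrableS measurableT (measurable_cbox a b) (@subsetT _ _) H.
    apply: eq_integrable H; first exact: measurable_cbox.
    move=> y; rewrite inE => -[y12 y3]; congr EFin.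
    by rewrite /patch mem_set// indicE mem_set// mulr1.
  move=> n a b ab abo; have [ab1 abo1] := box2 _ _ ab abo.
  rewrite Rintegral_supp; last first.
    move=> y yab; rewrite (_ : bump3 n a b y = bump2 n a.1 b.1 y.1 * bump n a.2 b.2 y.2)//.
    have [y1|/bump2_out ->] := pselect (cbox2 a.1 b.1 y.1); last by rewrite mul0r mulr0.
    rewrite bump_out_cc ?mulr0//; apply/negP => y3.
    by apply: yab; split.
  transitivity (\int[leb3]_y ((F \_ (cbox2 a.1 b.1) y.1 * bump2 n a.1 b.1 y.1)
      * bump n a.2 b.2 y.2)).
    congr Rintegral; apply/funext => y.
    rewrite (_ : bump3 n a b y = bump2 n a.1 b.1 y.1 * bump n a.2 b.2 y.2)// mulrA.
    congr (_ * _); rewrite /patch; case: ifPn => // /negP y1.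
    by rewrite bump2_out ?mulr0 ?mul0r// => y1'; apply: y1; exact/mem_set.
  have I2 := integrable_bounded_mulr (measurable_bump2 n a.1 b.1)
    (normr_bump2_le1 n a.1 b.1) (tens _ _ ab abo).
  have E := Rintegral_tensor I2 (bump_integrable n a.2 b.2).
  have Z : \int[leb2]_x (F \_ (cbox2 a.1 b.1) x * bump2 n a.1 b.1 x) = 0.
    transitivity (\int[leb2]_(x in cbox2 a.1 b.1)
        (F \_ (cbox2 a.1 b.1) x * bump2 n a.1 b.1 x)).
      apply/esym/Rintegral_supp => x xab.
      by rewrite bump2_out// mulr0.
    rewrite -[RHS](F0 n _ _ ab1 abo1).
    by apply: eq_Rintegral => x xab; rewrite /patch xab.
  exact: (etrans E (etrans (congr1 (fun t => t * _) Z) (mul0r _))).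
move=> /ae_xsection; apply: aeS => x [N [mN N0 PN]] ox.
apply: contrapT => Fx0.
(* If F does not vanish at x, the exceptional set contains the whole vertical line over x, which is
   not null. *)
have : (mu setT <= mu N)%E.
  apply: le_measure; rewrite ?inE// => z _; apply: PN => /= H.
  by apply: Fx0; exact: H.
by rewrite N0 (_ : setT = [set` `]-oo, +oo[ ]) ?lebesgue_measure_itv//= set_itvNyy.
Qed.

End PlaneTest.

Section CompactSupport.
Context {R : realType}.
Local Notation mu := (@lebesgue_measure R).

Lemma continuous_supp_bounded (f : R -> R) a b : continuous f ->
  (forall t, t \notin `[a, b] -> f t = 0) -> exists C, forall t, `|f t| <= C.
Proof.
move=> cf f0.
have H : {within `[a, b], continuous f} by exact: continuous_subspaceT.
have [M [_ HM]] := compact_bounded (continuous_compact H (@segment_compact _ a b)).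
exists (Num.max 0 (M + 1)) => t.
have [tab|tab] := boolP (t \in `[a, b]).
  rewrite le_max; apply/orP; right; apply: (HM (M + 1)); first by rewrite ltrDl.
  by exists t.
by rewrite f0// normr0 le_max lexx.
Qed.

Lemma Rintegral_derive_supp (F f : R -> R) a b : a < b ->
  (forall x : R, is_derive x (1 : R) F (f x)) -> continuous f ->
  (forall t, t \notin `]a, b[ -> F t = 0) ->
  (forall t, t \notin `]a, b[ -> f t = 0) -> \int[mu]_x f x = 0.
Proof.
move=> ab dF cf F0 f0.
have cF : continuous F.
  by move=> x; apply/differentiable_continuous/derivable1_diffP; have := dF x.
transitivity (\int[mu]_(x in `[a, b]) f x).
  apply/esym/Rintegral_supp => t tab.
  by apply: f0; apply/negP => /subset_itv_oo_cc; exact: tab.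
rewrite /Rintegral (@continuous_FTC2 _ f F a b ab).
- have Fa : F a = 0 by rewrite F0// in_itv/= ltxx.
  have Fb : F b = 0 by rewrite F0// in_itv/= ltxx andbF.
  by rewrite Fa Fb /= subrr.
- exact: continuous_subspaceT.
- split.
  + by move=> x _; have := dF x.
  + by apply: cvg_at_right_filter; exact: cF.
  + by apply: cvg_at_left_filter; exact: cF.
- by move=> x _; rewrite derive1E; have := dF x => ?; rewrite derive_val.
Qed.

Lemma Rintegral_parts_supp (z z' : R -> R) a b : a < b ->
  smooth_on [set: R] z -> smooth_on [set: R] z' ->
  (forall x : R, is_derive x (1 : R) z (z' x)) ->
  (forall t, t \notin `]a, b[ -> z t = 0 /\ z' t = 0) ->
  \int[mu]_x (x * z' x) = - \int[mu]_x z x.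
Proof.
move=> ab sz sz' dz z0.
have cz := smooth_continuous sz; have cz' := smooth_continuous sz'.
have czz : continuous (fun x : R => x * z' x).
  by move=> x; apply: cvgM; [exact: cvg_id|exact: cz'].
have supp : forall t, t \notin `[a, b] -> t \notin `]a, b[.
  by move=> t; apply: contra; exact: subset_itv_oo_cc.
have i1 : mu.-integrable setT (EFin \o (fun x => x * z' x)).
  apply: (@continuous_supp_integrable _ _ a b) => // t /supp /z0[_ ->].
  by rewrite mulr0.
have i2 : mu.-integrable setT (EFin \o z).
  by apply: (@continuous_supp_integrable _ _ a b) => // t /supp /z0[].
apply/eqP; rewrite -subr_eq0 opprK -RintegralD//; apply/eqP.
apply: (@Rintegral_derive_supp (fun x => x * z x) _ a b) => //.
- move=> x; have dzx := dz x.
  have := is_deriveM (is_derive_id x (1 : R)) dzx.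
  by rewrite (_ : _ + _ = x * z' x + z x)// /GRing.scale/= mulr1.
- by move=> x; apply: cvgD; [exact: czz|exact: cz].
- by move=> t /z0[-> _]; rewrite mulr0.
- by move=> t /z0[-> ->]; rewrite mulr0 addr0.
Qed.

End CompactSupport.

Section OpenOmega.
Context {R : realType}.

Lemma open_Omega (omega : set (R * R)) (h : R * R -> R) : open omega ->
  (forall x, omega x -> {for x, continuous h}) -> open (Omega omega h).
Proof.
move=> oo ch; rewrite openE => y [oy /andP[y0 yh]].
have c1 : {for y, continuous (fun z : R * R * R => h z.1 - z.2)}.
  apply: cvgB; last exact: cvg_snd.
  by apply: (@continuous_comp _ _ _ fst h); [exact: cvg_fst|exact: ch].
have c2 : {for y, continuous (snd : R * R * R -> R)} by exact: cvg_snd.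
rewrite /interior; near=> z; split.
  by near: z; exact: (open_cylinder oo).
apply/andP; split.
  by near: z; apply: (cvgr_gt (snd y) c2).
rewrite -subr_gt0; near: z; apply: (cvgr_gt (h y.1 - y.2) c1).
by rewrite subr_gt0.
Unshelve. all: by end_near. Qed.

End OpenOmega.

(** * The equation on vertical lines *)

Section DuBoisReymond.
Context {R : realType}.
Local Notation mu := (@lebesgue_measure R).
Local Notation T3 := (measurableTypeR R * measurableTypeR R * measurableTypeR R)%type.
Variables (omega : set (R * R)) (h : R * R -> R) (hmin : R).
Hypotheses (Om_open : open (Omega omega h))
  (hmin_gt0 : 0 < hmin) (h_ge : forall x, omega x -> hmin <= h x).
Variables (S : R * R * R -> R) (G : R * R -> R).
Hypothesis intS : forall a b, lt3 a b -> cbox a b `<=` Omega omega h ->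
  (@leb3 R).-integrable (cbox a b) (EFin \o S).
Hypothesis intG : forall a b, lt2 a b -> cbox2 a b `<=` omega ->
  (@leb2 R).-integrable (cbox2 a b) (EFin \o G).
Hypothesis wd : weak_d3 (Omega omega h) S (fun y => G y.1).

(** Any 0 < [m0] < [M0] < [hmin] would serve: the slab between these heights lies in the domain
    above every point of [omega]. *)
Let m0 := hmin / 4.
Let M0 := hmin / 2.
Let J := \int[mu]_t bump 0 m0 M0 t.

(* The constant of integration on the line above [x], as the mean of S - G z
   against a bump on which every line is contained in the domain. *)
Let c x := J^-1 * \int[mu]_t ((S (x, t) - G x * t) * bump 0 m0 M0 t).

Let m0_gt0 : 0 < m0. Proof. by rewrite divr_gt0. Qed.
Let m0_M0 : m0 < M0.
Proof. by rewrite /m0 /M0 ltr_pM2l// ltf_pV2 ?posrE// ltr_nat. Qed.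
Let M0_hmin : M0 < hmin.
Proof. by rewrite /M0 gtr_pMr// invf_lt1// ltr1n. Qed.
Let J_gt0 : 0 < J. Proof. exact: bump_integral_gt0. Qed.

Section Box.
Variables (a b : R * R * R).
Hypotheses (ab : lt3 a b) (abO : cbox a b `<=` Omega omega h).

Let K := cbox2 a.1 b.1.
(** The box is stretched vertically to contain the reference slab as well. It stays in the domain
    because the slice over x is the whole interval ]0, h x[. *)
Let m := Num.min a.2 m0.
Let M := Num.max b.2 M0.

Let a2_b2 : a.2 < b.2. Proof. by case: ab. Qed.

Let a2_gt0 : 0 < a.2.
Proof.
have H : cbox a b (a.1, a.2).
  by case: ab => ? ? ?; split; [split|]; rewrite /= in_itv/= lexx ltW.
by have [_ /andP[]] := abO H.
Qed.

Let K_omega x : K x -> omega x /\ b.2 < h x.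
Proof.
move=> Kx; have H : cbox a b (x, b.2) by split => //=; rewrite in_itv/= lexx ltW.
by have [ox /andP[_ bh]] := abO H.
Qed.

Let m_gt0 : 0 < m. Proof. by rewrite lt_min a2_gt0. Qed.
Let m_M : m < M.
Proof. by rewrite gt_min lt_max lt_max a2_b2. Qed.

Let ltm : lt3 (a.1, m) (b.1, M).
Proof. by case: ab. Qed.

Let BO : cbox (a.1, m) (b.1, M) `<=` Omega omega h.
Proof.
move=> [x t] [Kx /=]; rewrite in_itv/= => /andP[mt tM].
have [ox bh] := K_omega Kx; split => //=; rewrite (lt_le_trans m_gt0 mt)/=.
by rewrite (le_lt_trans tM)// gt_max bh (lt_le_trans M0_hmin)// h_ge.
Qed.

Let B := cbox (a.1, m) (b.1, M).

Let SB := S \_ B.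

Let I_SB : (@leb3 R).-integrable setT (EFin \o SB).
Proof. by apply: integrable_patch; [exact: measurable_cbox|exact: intS]. Qed.

Let GK := G \_ K.

Let I_GK : (@leb2 R).-integrable setT (EFin \o GK).
Proof.
apply: integrable_patch; first exact: measurable_cbox2.
by apply: intG; [case: ab|move=> x /K_omega[]].
Qed.

Let one (t : R) : R := \1_(`[m, M]%classic : set R) t.
Let z1 (t : R) : R := one t * t.

Let I_one : mu.-integrable setT (EFin \o (one : measurableTypeR R -> R)).
Proof. exact: integrable_itv. Qed.

Let I_z1 : mu.-integrable setT (EFin \o (z1 : measurableTypeR R -> R)).
Proof.
(* Clamping t to [m, M] gives a function bounded on the whole line that agrees with t where [one] is
   nonzero. *)
have mid : measurable_fun setT (fun t : measurableTypeR R => Num.max m (Num.min t M)).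
  by apply: measurable_maxr => //; exact: measurable_minr.
have bd (t : measurableTypeR R) : `|Num.max m (Num.min t M)| <= M.
  have max_ge0 : 0 <= Num.max m (Num.min t M) by rewrite le_max (ltW m_gt0).
  by rewrite (ger0_norm max_ge0) ge_max (ltW m_M)/= ge_min lexx orbT.
have := integrable_bounded_mulr mid bd I_one.
apply: eq_integrable => // t _ /=; congr EFin.
rewrite /z1 /one indicE; have [|_] := boolP (t \in _); last by rewrite !mul0r.
rewrite inE/= in_itv/= => /andP[mt tM].
by rewrite (min_idPl tM) (max_idPr mt).
Qed.

Let T (y : R * R * R) : R := SB y - GK y.1 * z1 y.2.

Let I_T : (@leb3 R).-integrable setT (EFin \o T).
Proof. exact: integrable_sub I_SB (integrable_tensor I_GK I_z1). Qed.

(** The reference bump normalized to integral 1. In this section the name hides the viscosity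
    function [psi] of the Carreau law, to which it is unrelated. *)
Let psi (t : R) : R := J^-1 * bump 0 m0 M0 t.

Let psi_out t : t \notin `]m, M[ -> psi t = 0.
Proof.
move=> tmM; rewrite /psi bump_out ?mulr0//; apply: contra tmM.
rewrite !in_itv/= => /andP[h1 h2].
by rewrite gt_min h1 orbT/= lt_max h2 orbT.
Qed.

Let T_in x t : K x -> t \in `[m, M] -> T (x, t) = S (x, t) - G x * t.
Proof.
move=> Kx tmM; rewrite /T /SB /GK /z1 /one /patch indicE.
rewrite !mem_set//= ?mul1r//.
Qed.

Let cK (x : R * R) : R := \int[mu]_t (T (x, t) * psi t).

Let cKE x : K x -> cK x = c x.
Proof.
move=> Kx; rewrite /cK /c -RintegralZl_any ?invr_gt0//.
congr Rintegral; apply/funext => t.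
have [tmM|tmM] := boolP (t \in `[m, M]); first by rewrite T_in// /psi; ring.
have E : psi t = 0.
  by apply: psi_out; apply: contra tmM; exact: subset_itv_oo_cc.
have Ji : J^-1 != 0 by rewrite invr_eq0 gt_eqF.
have b0 : bump 0 m0 M0 t = 0.
  by move/eqP: E; rewrite /psi mulf_eq0 (negbTE Ji) => /eqP.
by rewrite E b0 !mulr0.
Qed.

Let I_Tg (g : T3 -> R) (C : R) : measurable_fun setT g -> (forall y, `|g y| <= C) ->
  (@leb3 R).-integrable setT (EFin \o (fun y => T y * g y)).
Proof. by move=> mg gC; exact: integrable_bounded_mulr mg gC I_T. Qed.

Let smooth_psi : smooth_on [set: R] psi.
Proof. by move=> k; apply: CkM; [exact: Ck_cst|exact: smooth_bump]. Qed.

Let psi_bd : exists C, forall t, `|psi t| <= C.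
Proof.
apply: (@continuous_supp_bounded _ _ m M); first exact: smooth_continuous.
by move=> t tmM; apply: psi_out; apply: contra tmM; exact: subset_itv_oo_cc.
Qed.

Let m_snd (g : R -> R) : continuous g -> measurable_fun setT (fun y : T3 => g y.2).
Proof.
move=> cg; have mg : measurable_fun setT (g : measurableTypeR R -> R).
  exact: continuous_measurable_fun.
exact: (measurableT_comp mg).
Qed.

Let I_cK : (@leb2 R).-integrable setT (EFin \o cK).
Proof.
have [C psiC] := psi_bd.
have H := @I_Tg (fun y => psi y.2) C (m_snd (smooth_continuous smooth_psi))
  (fun y => psiC y.2).
exact: (integrable_Rintegral2 H).
Qed.

Let F (y : R * R * R) : R := S y - (c y.1 + G y.1 * y.2).

(** Agrees with [F] on the box, but is built from truncated pieces that are integrable over the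
    whole space, so that Fubini applies to it. *)
Let D (y : R * R * R) : R := T y - cK y.1 * one y.2.

Let DE y : cbox a b y -> F y = D y.
Proof.
move=> [Ky y2]; rewrite /F /D -cKE//.
have y2' : y.2 \in `[m, M].
  move: y2; rewrite /= !in_itv/= => /andP[h1 h2].
  by rewrite ge_min h1/= le_max h2.
rewrite (surjective_pairing y) T_in//= /one indicE mem_set//= mulr1.
ring.
Qed.

Lemma box_integrable : (@leb3 R).-integrable (cbox a b) (EFin \o F).
Proof.
have H : (@leb3 R).-integrable setT (EFin \o D).
  exact: integrable_sub I_T (integrable_tensor I_cK I_one).
have {}H := integrableS measurableT (measurable_cbox a b) (@subsetT _ _) H.
apply: eq_integrable H; first exact: measurable_cbox.
by move=> y; rewrite inE => /DE yE; congr EFin.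
Qed.

Section Test.
Variable n : nat.

Let theta := bump2 n a.1 b.1.
Let phi := bump n a.2 b.2.
Let beta := \int[mu]_t phi t.
(* [f] has zero integral, hence a compactly supported primitive, and
   [theta] times this primitive is an admissible test function. *)
Let f t := phi t + (- beta) * psi t.

Let I_psi : mu.-integrable setT (EFin \o psi).
Proof. exact: integrable_cst_mulr (bump_integrable 0 m0 M0). Qed.

Let psi_int1 : \int[mu]_t psi t = 1.
Proof. by rewrite RintegralZl_any ?invr_gt0// mulVf// gt_eqF. Qed.

Let smooth_f : smooth_on [set: R] f.
Proof.
move=> k; apply: CkD; first exact: smooth_bump.
by apply: CkM; [exact: Ck_cst|exact: smooth_psi].
Qed.

Let phi_out t : t \notin `]m, M[ -> phi t = 0.
Proof.
move=> tmM; apply: bump_out; apply: contra tmM.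
rewrite !in_itv/= => /andP[h1 h2].
by rewrite gt_min h1/= lt_max h2.
Qed.

Let f_out t : t \notin `]m, M[ -> f t = 0.
Proof. by move=> tmM; rewrite /f phi_out// psi_out// mulr0 addr0. Qed.

Let f_int0 : \int[mu]_t f t = 0.
Proof.
rewrite (RintegralD measurableT (bump_integrable n a.2 b.2)
  (integrable_cst_mulr (- beta) I_psi)).
by rewrite (RintegralZl _ measurableT I_psi) psi_int1 mulr1 subrr.
Qed.

(** Since [c] is an average against [psi], pairing [F] with theta phi amounts to pairing S - G t
    with theta f, where f = phi - beta psi has a compactly supported primitive z. The weak equation
    turns the S part into - int G theta int z, and int t f = - int z makes the G part cancel it. *)
Lemma box_test : \int[leb3]_(y in cbox a b) (F y * bump3 n a b y) = 0.
Proof.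
have [z [sz dz z0]] := smooth_primitive (ltW m_M) smooth_f f_out f_int0.
have z_out t : t \notin `]m, M[ -> z t = 0 /\ f t = 0.
  by move=> tmM; split; [exact: z0|exact: f_out].
have zparts := Rintegral_parts_supp m_M sz smooth_f dz z_out.
have out_cc g : (forall t, t \notin `]m, M[ -> g t = 0) ->
    forall t, t \notin `[m, M] -> (g t : R) = 0.
  by move=> g0 t tmM; apply: g0; apply: contra tmM; exact: subset_itv_oo_cc.
have IT (g : R -> R) : smooth_on [set: R] g -> (forall t, t \notin `]m, M[ -> g t = 0) ->
    (@leb3 R).-integrable setT (EFin \o (fun y : T3 => T y * (theta y.1 * g y.2))).
  move=> sg g0; have cg := smooth_continuous sg.
  have [C gC] := continuous_supp_bounded cg (out_cc _ g0).
  apply: (@I_Tg (fun y => theta y.1 * g y.2) C).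
    apply: measurable_funM; last exact: m_snd.
    exact: (measurableT_comp (measurable_bump2 _ _ _)).
  move=> y; rewrite normrM -[leRHS]mul1r.
  by apply: ler_pM => //; exact: normr_bump2_le1.
have I_phi := bump_integrable n a.2 b.2.
have I_cth := integrable_bounded_mulr (measurable_bump2 n a.1 b.1)
  (normr_bump2_le1 n a.1 b.1) I_cK.
have I_Gth := integrable_bounded_mulr (measurable_bump2 n a.1 b.1)
  (normr_bump2_le1 n a.1 b.1) I_GK.
have sphi : smooth_on [set: R] phi by exact: smooth_bump.
have E1 : \int[leb3]_(y in cbox a b) (F y * bump3 n a b y) =
    \int[leb3]_y (T y * (theta y.1 * phi y.2)) -
    \int[leb3]_y ((cK y.1 * theta y.1) * phi y.2).
  transitivity (\int[leb3]_(y in cbox a b) (D y * bump3 n a b y)).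
    by apply: eq_Rintegral => y; rewrite inE => /DE ->.
  transitivity (\int[leb3]_y (D y * bump3 n a b y)).
    apply: Rintegral_supp => y yab.
    rewrite (_ : bump3 n a b y = bump2 n a.1 b.1 y.1 * bump n a.2 b.2 y.2)//.
    have [y1|/bump2_out ->] := pselect (cbox2 a.1 b.1 y.1); last by rewrite mul0r mulr0.
    by rewrite bump_out_cc ?mulr0//; apply/negP => y3; apply: yab.
  transitivity (\int[leb3]_y (T y * (theta y.1 * phi y.2) -
      (cK y.1 * theta y.1) * phi y.2)).
    congr Rintegral; apply/funext => y.
    rewrite (_ : bump3 n a b y = theta y.1 * phi y.2)// /D.
    have : one y.2 * phi y.2 = phi y.2.
      have [ymM|ymM] := boolP (y.2 \in `[m, M]); last by rewrite (out_cc _ phi_out)// mulr0.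
      by rewrite /one indicE mem_set// mul1r.
    by move=> E; rewrite -{3}E; ring.
  exact: (RintegralB measurableT (IT _ sphi phi_out) (integrable_tensor I_cth I_phi)).
have E2 : \int[leb3]_y ((cK y.1 * theta y.1) * phi y.2) =
    beta * \int[leb3]_y (T y * (theta y.1 * psi y.2)).
  transitivity (\int[leb2]_x (cK x * theta x) * beta).
    exact: (Rintegral_tensor I_cth I_phi).
  rewrite mulrC; congr (_ * _).
  transitivity (\int[leb2]_x \int[mu]_t (T (x, t) * (theta x * psi t))); last first.
    exact: esym (Rintegral_fubini (IT _ smooth_psi psi_out)).
  congr Rintegral; apply/funext => x.
  rewrite mulrC /cK -RintegralZl_ge0; last exact: bump2_ge0.
  by congr Rintegral; apply/funext => t; rewrite /theta; ring.
have E3 : \int[leb3]_y (T y * (theta y.1 * phi y.2)) -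
    beta * \int[leb3]_y (T y * (theta y.1 * psi y.2)) =
    \int[leb3]_y (T y * (theta y.1 * f y.2)).
  transitivity (\int[leb3]_y (T y * (theta y.1 * phi y.2)) +
      \int[leb3]_y (- beta * (T y * (theta y.1 * psi y.2)))).
    congr (_ + _); rewrite -mulNr; apply: esym.
    exact: (RintegralZl (- beta) measurableT (IT _ smooth_psi psi_out)).
  transitivity (\int[leb3]_y (T y * (theta y.1 * phi y.2) +
      - beta * (T y * (theta y.1 * psi y.2)))).
    apply: esym; apply: (RintegralD measurableT (IT _ sphi phi_out)).
    exact: (integrable_cst_mulr (- beta) (IT _ smooth_psi psi_out)).
  by congr Rintegral; apply/funext => y; rewrite /f; ring.
have I_f : mu.-integrable setT (EFin \o f).
  apply: (@continuous_supp_integrable _ _ m M); first exact: smooth_continuous.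
  exact: out_cc f_out.
have I_z : mu.-integrable setT (EFin \o z).
  apply: (@continuous_supp_integrable _ _ m M); first exact: smooth_continuous.
  exact: out_cc z0.
have [Cf fCf] := continuous_supp_bounded (smooth_continuous smooth_f) (out_cc _ f_out).
have mf : measurable_fun setT (f : measurableTypeR R -> R).
  by have cf := smooth_continuous smooth_f; exact: continuous_measurable_fun.
have I_z1f := integrable_bounded_mulr mf fCf I_z1.
have z1f t : z1 t * f t = t * f t.
  rewrite /z1 /one indicE; have [|/negP tmM] := boolP (t \in _); first by rewrite mul1r.
  rewrite (out_cc _ f_out) ?mulr0//; apply/negP => H; apply: tmM.
  exact/mem_set.
have I_SBf : (@leb3 R).-integrable setT (EFin \o (fun y : T3 => SB y * (theta y.1 * f y.2))).
  apply: (@integrable_bounded_mulr _ _ _ _ _ (fun y : T3 => theta y.1 * f y.2) Cf) => //.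
    apply: measurable_funM; last by apply: m_snd; exact: smooth_continuous.
    exact: (measurableT_comp (measurable_bump2 _ _ _)).
  move=> y; rewrite normrM -[leRHS]mul1r.
  by apply: ler_pM => //; exact: normr_bump2_le1.
have E4 : \int[leb3]_y (T y * (theta y.1 * f y.2)) =
    \int[leb3]_y (SB y * (theta y.1 * f y.2)) -
    \int[leb3]_y ((GK y.1 * theta y.1) * (z1 y.2 * f y.2)).
  transitivity (\int[leb3]_y (SB y * (theta y.1 * f y.2) -
      (GK y.1 * theta y.1) * (z1 y.2 * f y.2))).
    by congr Rintegral; apply/funext => y; rewrite /T; ring.
  exact: (RintegralB measurableT I_SBf (integrable_tensor I_Gth I_z1f)).
have E5 : \int[leb3]_y ((GK y.1 * theta y.1) * (z1 y.2 * f y.2)) =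
    \int[leb2]_x (GK x * theta x) * \int[mu]_t (t * f t).
  transitivity (\int[leb2]_x (GK x * theta x) * \int[mu]_t (z1 t * f t)).
    exact: (Rintegral_tensor I_Gth I_z1f).
  by congr (_ * _); congr Rintegral; apply/funext => t; exact: z1f.
pose test (y : R * R * R) := bump n a.1.1 b.1.1 y.1.1 * bump n a.1.2 b.1.2 y.1.2 * z y.2.
have tf : test_fun (Omega omega h) test.
  apply: (@test_fun_box _ _ _ _ _ a.1.1 b.1.1 a.1.2 b.1.2 m M) => //.
  - exact: smooth_bump.
  - exact: smooth_bump.
  - by move=> t; exact: bump_out.
  - by move=> t; exact: bump_out.
have B_out y : ~ B y -> theta y.1 * f y.2 = 0 /\ theta y.1 * z y.2 = 0.
  move=> yB; have [y1|/bump2_out E] := pselect (cbox2 a.1 b.1 y.1); last first.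
    by rewrite /theta E !mul0r.
  have ymM : y.2 \notin `[m, M] by apply/negP => ymM; apply: yB.
  by rewrite (out_cc _ f_out)// (out_cc _ z0)// !mulr0.
(* The weak equation enters here, tested with theta(x) z(y3), whose y3-derivative is theta f. *)
have E6 : \int[leb3]_y (SB y * (theta y.1 * f y.2)) =
    - (\int[leb2]_x (GK x * theta x) * \int[mu]_t z t).
  transitivity (\int[leb3]_(y in Omega omega h) (S y * 'D_e3 test y)).
    transitivity (\int[leb3]_(y in Omega omega h) (SB y * (theta y.1 * f y.2))).
      apply/esym/Rintegral_supp => y yO.
      have [] := B_out y; first by move=> /BO.
      by move=> -> _; rewrite mulr0.
    apply: eq_Rintegral => y _; rewrite /test (derive_e3 _ _ _ dz).
    rewrite -[bump _ _ _ _ * bump _ _ _ _]/(theta y.1).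
    have [yB|yB] := pselect (B y); first by rewrite /SB patchE mem_set.
    by have [-> _] := B_out y yB; rewrite !mulr0.
  rewrite (wd tf); congr (- _).
  transitivity (\int[leb3]_y ((GK y.1 * theta y.1) * z y.2)); last first.
    exact: (Rintegral_tensor I_Gth I_z).
  transitivity (\int[leb3]_(y in Omega omega h) ((GK y.1 * theta y.1) * z y.2)).
    apply: eq_Rintegral => y _; rewrite -mulrA.
    rewrite -[test y]/(theta y.1 * z y.2).
    have [yB|yB] := pselect (B y).
      by rewrite /GK patchE mem_set//; case: yB.
    by have [_ ->] := B_out y yB; rewrite !mulr0.
  apply: Rintegral_supp => y yO; rewrite -mulrA.
  have [] := B_out y; first by move=> /BO.
  by move=> _ ->; rewrite mulr0.
rewrite E1 E2 E3 E4 E5 E6 zparts; ring.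
Qed.

End Test.
End Box.

Lemma weak_d3_affine : exists c : R * R -> R,
  {ae @leb3 R, forall y, Omega omega h y -> S y = c y.1 + G y.1 * y.2}.
Proof.
exists c.
have : {ae @leb3 R, forall y, Omega omega h y -> S y - (c y.1 + G y.1 * y.2) = 0}.
  apply: ae_eq0_test => //.
  - by move=> a b ab abO; exact: box_integrable.
  - by move=> n a b ab abO; exact: box_test.
by apply: aeS => y + Oy => /(_ Oy) /eqP; rewrite subr_eq0 => /eqP.
Qed.

End DuBoisReymond.

(** * Zero traces as integral identities on vertical lines *)

Section Traces.
Context {R : realType}.
Local Notation mu := (@lebesgue_measure R).
Local Notation T3 := (measurableTypeR R * measurableTypeR R * measurableTypeR R)%type.

Variables (omega : set (R * R)) (h : R * R -> R) (H : R).
Hypotheses (omega_open : open omega) (H_ge0 : 0 <= H)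
  (h_le : forall x, omega x -> h x <= H).
Variables (w dw : R * R * R -> R).

Let Om := Omega omega h.
Let W := w \_ Om.
Let DW := dw \_ Om.

Hypothesis intW : forall a b, lt2 a b -> cbox2 a b `<=` omega ->
  (@leb3 R).-integrable (cbox (a, - 2) (b, H + 2)) (EFin \o W).
Hypothesis intDW : forall a b, lt2 a b -> cbox2 a b `<=` omega ->
  (@leb3 R).-integrable (cbox (a, - 2) (b, H + 2)) (EFin \o DW).
Hypothesis tr : has_traces omega h w dw (cst 0) (cst 0).

(** Green's formula is tested with theta(x) z(y3), where z need not vanish at heights 0 and h x; the
    zero traces remove the boundary term. As theta runs over all planar bumps, the fundamental lemma
    in the plane isolates the integral on almost every line. *)
Lemma trace_slice (z z' : R -> R) : smooth_on [set: R] z -> smooth_on [set: R] z' ->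
  (forall x : R, is_derive x (1 : R) z (z' x)) ->
  (forall t, t \notin `]- 2, H + 2[ -> z t = 0 /\ z' t = 0) ->
  {ae @leb2 R, forall x, omega x ->
     \int[mu]_t (W (x, t) * z' t + DW (x, t) * z t) = 0}.
Proof.
move=> sz sz' dz z_out.
have z_cc t : t \notin `[- 2, H + 2] -> z t = 0 /\ z' t = 0.
  by move=> tH; apply: z_out; apply: contra tH; exact: subset_itv_oo_cc.
have bd (g : R -> R) : smooth_on [set: R] g ->
    (forall t, t \notin `[- 2, H + 2] -> g t = 0) ->
    exists C, measurable_fun setT (fun y : T3 => g y.2) /\ (forall y : T3, `|g y.2| <= C).
  move=> sg g0; have cg := smooth_continuous sg.
  have [C gC] := continuous_supp_bounded cg g0; exists C; split => //.
  have mg : measurable_fun setT (g : measurableTypeR R -> R).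
    exact: continuous_measurable_fun.
  exact: (measurableT_comp mg).
have [C [mz zC]] := bd z sz (fun t tH => (z_cc t tH).1).
have [C' [mz' zC']] := bd z' sz' (fun t tH => (z_cc t tH).2).
pose Q a b (y : R * R * R) : R := (W \_ (cbox (a, - 2) (b, H + 2))) y * z' y.2 +
  (DW \_ (cbox (a, - 2) (b, H + 2))) y * z y.2.
have IQ a b : lt2 a b -> cbox2 a b `<=` omega ->
    (@leb3 R).-integrable setT (EFin \o Q a b).
  move=> ab abo; apply: integrable_add.
    apply: (integrable_bounded_mulr mz' zC'); apply: integrable_patch.
      exact: measurable_cbox.
    exact: intW.
  apply: (integrable_bounded_mulr mz zC); apply: integrable_patch.
    exact: measurable_cbox.
  exact: intDW.
have QE a b x t : cbox2 a b x -> Q a b (x, t) = W (x, t) * z' t + DW (x, t) * z t.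
  move=> xab; rewrite /Q /=.
  have [tH|tH] := boolP (t \in `[- 2, H + 2]).
    by rewrite {1 2}/patch !mem_set.
  by have [-> ->] := z_cc t tH; rewrite !mulr0.
have FE a b x : cbox2 a b x ->
    \int[mu]_t (W (x, t) * z' t + DW (x, t) * z t) = \int[mu]_t Q a b (x, t).
  by move=> xab; congr Rintegral; apply/funext => t; rewrite QE.
apply: ae_eq0_test2 => //.
  move=> a b ab abo.
  have := integrableS measurableT (measurable_cbox2 a b) (@subsetT _ _)
    (integrable_Rintegral2 (IQ a b ab abo)).
  apply: eq_integrable; first exact: measurable_cbox2.
  by move=> x; rewrite inE => xab /=; congr EFin; exact/esym/FE.
move=> n a b ab abo.
have mth := measurable_bump2 n a b.
pose theta := bump2 n a b.
transitivity (\int[leb2]_x \int[mu]_t (Q a b (x, t) * theta x)).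
  transitivity (\int[leb2]_(x in cbox2 a b) \int[mu]_t (Q a b (x, t) * theta x)).
    apply: eq_Rintegral => x; rewrite inE => xab.
    rewrite (FE a b)// mulrC -RintegralZl_ge0; last exact: bump2_ge0.
    by congr Rintegral; apply/funext => t; rewrite mulrC.
  apply: Rintegral_supp => x xab.
  transitivity (\int[mu]_(t in [set: R]) (0 : R)); last by rewrite /Rintegral integral0.
  by congr Rintegral; apply/funext => t; rewrite /theta bump2_out// mulr0.
have mth3 : measurable_fun setT (fun y : T3 => theta y.1).
  exact: (measurableT_comp mth).
have IQt : (@leb3 R).-integrable setT (EFin \o (fun y : T3 => Q a b y * theta y.1)).
  exact: (integrable_bounded_mulr mth3 (fun y => normr_bump2_le1 n a b y.1) (IQ a b ab abo)).
transitivity (\int[leb3]_y (Q a b y * theta y.1)).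
  exact: esym (Rintegral_fubini IQt).
pose test (y : R * R * R) := bump n a.1 b.1 y.1.1 * bump n a.2 b.2 y.1.2 * z y.2.
have tf : test_fun [set y | omega y.1] test.
  apply: (@test_fun_box _ _ _ _ _ a.1 b.1 a.2 b.2 (- 2) (H + 2)) => //.
  - exact: smooth_bump.
  - exact: smooth_bump.
  - by move=> t; exact: bump_out.
  - by move=> t; exact: bump_out.
  - by move=> t /z_out[].
  - by move=> y [yab _]; exact: abo.
transitivity (\int[leb3]_(y in Om) (w y * 'D_e3 test y + dw y * test y)).
  transitivity (\int[leb3]_(y in Om) (Q a b y * theta y.1)).
    apply/esym/Rintegral_supp => y yO.
    rewrite /Q /W /DW {1 3}/patch.
    have E (g : R * R * R -> R) : (g \_ Om) y = 0 by rewrite /patch memNset.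
    by case: ifPn => _; rewrite ?E !mul0r addr0 mul0r.
  apply: eq_Rintegral => y; rewrite inE => yO.
  rewrite /test (derive_e3 _ _ _ dz) -[bump _ _ _ _ * bump _ _ _ _]/(theta y.1).
  have [y1|/bump2_out E] := pselect (cbox2 a b y.1); last first.
    by rewrite /theta E !(mul0r, mulr0) addr0.
  rewrite [in Q _ _ _](surjective_pairing y) QE// -surjective_pairing.
  have E (g : R * R * R -> R) : (g \_ Om) y = g y by rewrite /patch mem_set.
  by rewrite /W /DW !E; ring.
rewrite (tr tf); transitivity (\int[leb2]_(x in omega) (0 : R)).
  by congr Rintegral; apply/funext => x; rewrite /cst !mul0r subrr.
by rewrite /Rintegral integral0.
Qed.

(** The plateau function z and t z(t) replace the profiles 1 and t, which have no compact support.
    [W] and [DW] vanish outside [0, H], where these functions are c and c t, and c is divided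
    out. *)
Lemma trace_moments : {ae @leb2 R, forall x, omega x ->
  \int[mu]_t DW (x, t) = 0 /\ \int[mu]_t (W (x, t) + t * DW (x, t)) = 0}.
Proof.
have [z [z' [c [sz dz [sz' z_out] c0 zc]]]] := cutoff_exists H_ge0.
have A1 := trace_slice sz sz' dz z_out.
have dtz (x : R) : is_derive x (1 : R) (fun t => t * z t) (z x + x * z' x).
  rewrite [z x + _]addrC; have dzx := dz x.
  have := is_deriveM (is_derive_id x (1 : R)) dzx.
  by rewrite (_ : _ + _ = x * z' x + z x)// /GRing.scale/= mulr1.
have stz : smooth_on [set: R] (fun t => t * z t).
  by apply: smooth_onM => //; exact: smooth_on_id.
have stz' : smooth_on [set: R] (fun t => z t + t * z' t).
  by move=> k; apply: CkD; [exact: sz|apply: CkM; [exact: smooth_on_id|exact: sz']].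
have tz_out t : t \notin `]- 2, H + 2[ -> t * z t = 0 /\ z t + t * z' t = 0.
  by move=> /z_out[-> ->]; rewrite !mulr0 addr0.
have A2 := trace_slice stz stz' dtz tz_out.
have supp x t : omega x -> t \notin `[0, H] -> W (x, t) = 0 /\ DW (x, t) = 0.
  move=> ox tH; have tO : ~ Om (x, t).
    move=> [_ /= /andP[t0 th]]; move/negP: tH; apply.
    by rewrite in_itv/= (ltW t0) (le_trans (ltW th))// h_le.
  by rewrite /W /DW /patch memNset.
apply: aeS2 A1 A2 => x A1 A2 ox; split.
  have := A1 ox; rewrite (_ : Rintegral _ _ _ = c * \int[mu]_t DW (x, t)).
    by move/eqP; rewrite mulf_eq0 gt_eqF//= => /eqP.
  rewrite -RintegralZl_any//; congr Rintegral; apply/funext => t.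
  have [/zc[-> ->]|/(supp _ _ ox)[-> ->]] := boolP (t \in `[0, H]).
    by ring.
  by ring.
have := A2 ox; rewrite (_ : Rintegral _ _ _ = c * \int[mu]_t (W (x, t) + t * DW (x, t))).
  by move/eqP; rewrite mulf_eq0 gt_eqF//= => /eqP.
rewrite -RintegralZl_any//; congr Rintegral; apply/funext => t.
have [/zc[-> ->]|/(supp _ _ ox)[-> ->]] := boolP (t \in `[0, H]).
  by ring.
by ring.
Qed.

End Traces.

(** * The Carreau problem on a single vertical segment *)

Section Slice.
Context {R : realType}.
Local Notation mu := (@lebesgue_measure R).
Variables (r eta0 lambda : R).
Hypotheses (r_gt1 : 1 < r) (r_neq2 : r != 2) (eta0_gt0 : 0 < eta0)
  (lambda_gt0 : 0 < lambda).

Lemma ae_neq (c : R) : {ae mu, forall x, x != c}.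
Proof.
exists [set c]; split; [exact: measurable_set1|exact: lebesgue_measure_set1|].
by move=> x /= /negP; rewrite negbK => /eqP.
Qed.

Lemma carreau_viscN (s : R * R) : carreau_visc lambda r (- s) = carreau_visc lambda r s.
Proof. by rewrite /carreau_visc -scaleN1r enormZ normrN1 mul1r. Qed.

Lemma ae_eq0_of_ge0 (f : R -> R) : mu.-integrable setT (EFin \o f) ->
  {ae mu, forall x, 0 <= f x} -> \int[mu]_x f x = 0 -> {ae mu, forall x, f x = 0}.
Proof.
move=> intf f_ge0 f0.
have : ae_eq mu setT (EFin \o f) (cst 0%E).
  apply/ae_eq_integral_abs => //; first exact: measurable_int intf.
  transitivity (\int[mu]_x (f x)%:E)%E.
    by apply: ae_eq_integral_any; apply: aeS f_ge0 => x fx _ /=; rewrite ger0_norm.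
  by rewrite -[LHS]fineK ?integrable_fin_num//; congr EFin.
by apply: aeS => x /(_ Logic.I) [].
Qed.

Variable hx : R.
Hypothesis hx_gt0 : 0 < hx.

Section Component.
Variables (D : R -> R) (gi : R) (g : R * R).
Hypotheses (intD : mu.-integrable setT (EFin \o D))
  (D_out : forall z, z \notin `]0, hx[ -> D z = 0) (D_int0 : \int[mu]_z D z = 0)
  (DE : {ae mu, forall z, z \in `]0, hx[ ->
     D z = 2 * (hx / 2 - z) / psi r eta0 lambda (2 * enorm g * `|hx / 2 - z|) * gi}).

Lemma integrable_moment : mu.-integrable setT (EFin \o (fun z => z * D z)).
Proof.
have mid : measurable_fun setT (fun t : measurableTypeR R => Num.max 0 (Num.min t hx)).
  by apply: measurable_maxr => //; exact: measurable_minr.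
have bd (t : measurableTypeR R) : `|Num.max 0 (Num.min t hx)| <= hx.
  have max_ge0 : 0 <= Num.max 0 (Num.min t hx) by rewrite le_max lexx.
  by rewrite (ger0_norm max_ge0) ge_max (ltW hx_gt0)/= ge_min lexx orbT.
have := integrable_bounded_mulr mid bd intD.
apply: eq_integrable => // t _ /=; congr EFin.
have [|/D_out ->] := boolP (t \in `]0, hx[); last by rewrite mul0r mulr0.
rewrite in_itv/= => /andP[t0 th].
by rewrite (min_idPl (ltW th)) (max_idPr (ltW t0)) mulrC.
Qed.

(** With z = hx/2 - xi, (hx - z) D(z) is 2 gi times the mobility integrand, and its integral is -
    int z D because D has zero integral. The case gi = 0 is set apart since the integrand is
    recovered by dividing by 2 gi; there both sides vanish. *)
Lemma moment_mobility :
  \int[mu]_z (z * D z) = - (2 * mobility r eta0 lambda hx g * gi).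
Proof.
have [gi0|gi0] := eqVneq gi 0.
  rewrite gi0 mulr0 oppr0; transitivity (\int[mu]_(z in [set: R]) (0 : R)).
    apply: Rintegral_ae_eq; apply: aeS DE => z Dz _.
    have [/Dz ->|/D_out ->] := boolP (z \in `]0, hx[); last by rewrite mulr0.
    by rewrite gi0 !mulr0.
  by rewrite /Rintegral integral0.
pose m z := hx * D z - z * D z.
have int_m : mu.-integrable setT (EFin \o m).
  by apply: integrable_sub; [exact: integrable_cst_mulr|exact: integrable_moment].
have E : mobility r eta0 lambda hx g = (2 * gi)^-1 * \int[mu]_z m z.
  transitivity (\int[mu]_(xi in `[- (hx / 2), hx / 2]) ((2 * gi)^-1 * m (hx / 2 - xi))).
    rewrite /mobility; apply: Rintegral_ae_eq.
    have n1 := ae_neq (hx / 2); have n2 := ae_neq (- (hx / 2)).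
    have DE' := ae_refl (hx / 2) DE.
    apply: aeS2 (aeS2 (fun x p q => conj p q) n1 n2) DE' => xi [x1 x2] Dxi.
    rewrite /= in_itv/= => /andP[h1 h2].
    have xi_in : hx / 2 - xi \in `]0, hx[.
      have {}h1 : - (hx / 2) < xi by rewrite lt_neqAle eq_sym x2.
      have {}h2 : xi < hx / 2 by rewrite lt_neqAle x1.
      rewrite in_itv/=; apply/andP; split; first by rewrite subr_gt0.
      by rewrite ltrBlDr -ltrBlDl (_ : hx / 2 - hx = - (hx / 2)) //; field.
    rewrite /m (Dxi xi_in) opprB addrCA subrr addr0.
    (* With the convention that the inverse of 0 is 0, both sides vanish where [psi] would be 0, so
       its positivity need not be invoked. *)
    have [->|p0] := eqVneq (psi r eta0 lambda (2 * enorm g * `|xi|)) 0.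
      by rewrite !invr0 !(mulr0, mul0r) subr0 mulr0.
    by field; rewrite gi0 p0.
  transitivity (\int[mu]_xi ((2 * gi)^-1 * m (hx / 2 - xi))).
    apply: Rintegral_supp => xi /= xi_out.
    rewrite /m D_out ?mulr0 ?subr0 ?mulr0//; apply/negP; rewrite in_itv/= => /andP[h1 h2].
    apply: xi_out; rewrite in_itv/=; apply/andP; split; lra.
  rewrite RintegralZl//; last exact: integrable_refl int_m.
  by congr (_ * _); exact: Rintegral_refl.
have Em : \int[mu]_z m z = - \int[mu]_z (z * D z).
  transitivity (\int[mu]_z (hx * D z) - \int[mu]_z (z * D z)).
    apply: (RintegralB measurableT); last exact: integrable_moment.
    exact: integrable_cst_mulr.
  by rewrite RintegralZl// D_int0 mulr0 sub0r.
rewrite E Em; field; exact: gi0.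
Qed.

End Component.

Variables (D1 D2 : R -> R) (k g : R * R).
Hypotheses (intD1 : mu.-integrable setT (EFin \o D1))
  (intD2 : mu.-integrable setT (EFin \o D2))
  (D1_out : forall z, z \notin `]0, hx[ -> D1 z = 0)
  (D2_out : forall z, z \notin `]0, hx[ -> D2 z = 0)
  (D1_int0 : \int[mu]_z D1 z = 0) (D2_int0 : \int[mu]_z D2 z = 0)
  (stressE : {ae mu, forall z, z \in `]0, hx[ ->
     carreau_visc lambda r (D1 z, D2 z) *: (D1 z, D2 z) = k - (2 / eta0 * z) *: g}).

Let D z : R * R := (D1 z, D2 z).

Lemma slice_velocity_gradient : {ae mu, forall z, z \in `]0, hx[ ->
  D z = (2 * (hx / 2 - z) / psi r eta0 lambda (2 * enorm g * `|hx / 2 - z|)) *: g}.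
Proof.
have stressE' := ae_refl hx stressE.
(* The unknown constant k enters both stresses with the same sign once the reflected one is moved
   across, and the z-dependent parts add up to the constant slope times hx. *)
pose q : R * R := k + k - (2 / eta0 * hx) *: g.
have reflP z : z \in `]0, hx[ -> hx - z \in `]0, hx[.
  by rewrite !in_itv/= subr_gt0 ltrBlDr ltrDl andbC.
have diffE : {ae mu, forall z, z \in `]0, hx[ ->
    carreau_visc lambda r (D z) *: D z
    - carreau_visc lambda r (- D (hx - z)) *: (- D (hx - z)) = q}.
  apply: aeS2 stressE stressE' => z e1 e2 zh.
  rewrite carreau_viscN scalerN opprK /D (e1 zh) (e2 (reflP _ zh)) /q.
  by rewrite addrACA -opprD -scalerDl -mulrDr subrKC.
(* [P] is the pairing of the constant [q] with D(z) + D(hx - z), so it has zero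
   integral; it is nonnegative by monotonicity. *)
pose P z : R := q.1 * (D1 z + D1 (hx - z)) + q.2 * (D2 z + D2 (hx - z)).
have intP : mu.-integrable setT (EFin \o P).
  by apply: integrable_add; apply: integrable_cst_mulr; apply: integrable_add => //;
    exact: integrable_refl.
have P_int0 : \int[mu]_z P z = 0.
  have hD (F : R -> R) : mu.-integrable setT (EFin \o F) -> \int[mu]_z F z = 0 ->
      \int[mu]_z (F z + F (hx - z)) = 0.
    move=> iF F0.
    transitivity (\int[mu]_z F z + \int[mu]_z F (hx - z)).
      exact: (RintegralD measurableT iF (integrable_refl hx iF)).
    by rewrite Rintegral_refl// F0 addr0.
  transitivity (\int[mu]_z (q.1 * (D1 z + D1 (hx - z))) +
      \int[mu]_z (q.2 * (D2 z + D2 (hx - z)))).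
    by apply: (RintegralD measurableT); apply: integrable_cst_mulr;
      apply: integrable_add => //;
      exact: integrable_refl.
  rewrite !RintegralZl ?hD ?mulr0 ?addr0//;
    by apply: integrable_add => //; exact: integrable_refl.
have PE z : P z = dot q (D z - (- D (hx - z))) by rewrite opprK.
have P_ge0 : {ae mu, forall z, 0 <= P z}.
  apply: aeS diffE => z qE.
  have [zh|zh] := boolP (z \in `]0, hx[).
    by rewrite PE -(qE zh); exact: carreau_monotone.
  have zh' : hx - z \notin `]0, hx[.
    by apply: contra zh => /reflP; rewrite opprB subrKC.
  by rewrite /P D1_out// D2_out// D1_out// D2_out// !addr0 !mulr0 addr0.
have P0 := ae_eq0_of_ge0 intP P_ge0 P_int0.
apply: aeS2 (aeS2 (fun x p q => conj p q) diffE P0) stressE => z [qE Pz] e1 zh.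
apply: carreau_law_inv => //.
have DD : D z = - D (hx - z).
  by apply: (carreau_strict_monotone r_gt1 lambda_gt0); rewrite (qE zh) -PE.
(* Once D(z) = - D(hx - z), the two stresses agree and q vanishes. This determines the integration
   constant as k = (hx / eta0) g, and the stress becomes (2 / eta0) (hx/2 - z) g. *)
have q0 : q = 0 by rewrite -(qE zh) DD subrr.
rewrite /D (e1 zh).
have kE : k = (hx / eta0) *: g.
  have : k + k = (2 / eta0 * hx) *: g by apply/eqP; rewrite -subr_eq0 -/q q0.
  rewrite -mulr2n -scaler_nat => /(congr1 (fun v => 2^-1 *: v)).
  rewrite !scalerA mulVf ?pnatr_eq0// scale1r => ->.
  by congr (_ *: _); field; rewrite gt_eqF.
rewrite kE -scalerBl; congr (_ *: _); field; by rewrite gt_eqF.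
Qed.

Lemma slice_moments :
  \int[mu]_z (z * D1 z) = - (2 * mobility r eta0 lambda hx g * g.1) /\
  \int[mu]_z (z * D2 z) = - (2 * mobility r eta0 lambda hx g * g.2).
Proof.
split; apply: moment_mobility => //.
  by apply: aeS slice_velocity_gradient => z Dz /Dz /(congr1 fst).
by apply: aeS slice_velocity_gradient => z Dz /Dz /(congr1 snd).
Qed.

End Slice.

(** * Local integrability *)

Section LpIntegrability.
Context {d} {T : measurableType d} {R : realType}.
Variable mu : {measure set T -> \bar R}.
Implicit Types (A B : set T) (g : T -> R).

(** Plays the role of Hölder's inequality: it makes L^q functions integrable on sets of finite
    measure. *)
Lemma norm_le_powR (q t : R) : 1 <= q -> `|t| <= 1 + `|t| `^ q.
Proof.
move=> q1; have [t1|t1] := leP 1 `|t|.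
  by apply: le_trans (le1r_powR t1 q1) _; rewrite lerDr.
by apply: (le_trans (ltW t1)); rewrite lerDl powR_ge0.
Qed.

Lemma Lp_on_measurable A (q : \bar R) g : Lp_on mu A q g -> measurable_fun setT (g \_ A).
Proof. by rewrite /Lp_on inE => /andP[/[!inE]]. Qed.

Lemma Lp_on_powR_integrable A (q : R) g : 1 <= q -> Lp_on mu A q%:E g ->
  mu.-integrable setT (EFin \o (fun x => `|(g \_ A) x| `^ q)).
Proof. by move=> q1 /(Lfun_integrable q1). Qed.

Lemma integrable_cst_fin B (C : R) : measurable B -> (mu B < +oo)%E ->
  mu.-integrable B (EFin \o cst C).
Proof.
move=> mB B_fin; apply: measurable_bounded_integrable => //.
by exists `|C|; split; [exact: num_real|move=> M CM x _ /=; exact: ltW].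
Qed.

Lemma Lp_on_integrable A B (q : R) g : 1 <= q -> Lp_on mu A q%:E g ->
  measurable B -> (mu B < +oo)%E -> mu.-integrable B (EFin \o (g \_ A)).
Proof.
move=> q1 gA mB B_fin.
have i1 := integrable_cst_fin 1 mB B_fin.
have i2 := integrableS measurableT mB (@subsetT _ _) (Lp_on_powR_integrable q1 gA).
apply: le_integrable (integrableD mB i1 i2) => //.
  apply/measurable_EFinP; apply: measurable_funTS; exact: Lp_on_measurable gA.
move=> x _ /=; rewrite lee_fin [leRHS]ger0_norm ?norm_le_powR//.
Qed.

(** Almost everywhere |g| equals its truncation at an essential bound M, and the truncation is
    dominated by a constant on a set of finite measure. *)
Lemma Linf_on_integrable A B g : Lp_on mu A +oo%E g ->
  measurable B -> (mu B < +oo)%E -> mu.-integrable B (EFin \o (g \_ A)).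
Proof.
move=> gA mB B_fin.
have mg := Lp_on_measurable gA.
have [M M0 gM] : exists2 M : R, 0 <= M & {ae mu, forall x, `|(g \_ A) x| <= M}.
  (* A null space is treated apart because the norm unfolds to an essential supremum only for
     [0 < mu setT]. *)
  have [T0|T0] := eqVneq (mu setT) 0%E.
    by exists 0 => //; exists setT; split.
  have Tpos : (0 < mu setT)%E by rewrite lt_def T0 measure_ge0.
  move: gA; rewrite /Lp_on inE => /andP[_ /[!inE]/=].
  rewrite /finite_norm unlock Tpos => ess_fin.
  have := ess_sup_ge mu (abse \o (EFin \o (g \_ A))).
  move: ess_fin; case: ess_sup => [M _|//|_] gM.
    exists (Num.max 0 M); first by rewrite le_max lexx.
    by apply: aeS gM => x; rewrite lee_fin => gx; rewrite le_max gx orbT.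
  by exists 0 => //; apply: aeS gM => x; rewrite leeNy_eq.
apply/integrableP; split; first exact/measurable_EFinP/measurable_funTS.
pose f x := Num.min `|(g \_ A) x| M.
have -> : (\int[mu]_(x in B) `|(EFin \o g \_ A) x| = \int[mu]_(x in B) (f x)%:E)%E.
  by apply: ae_eq_integral_any; apply: aeS gM => x gx _; rewrite /f (min_idPl gx).
have mf : measurable_fun setT f.
  by apply: measurable_minr => //; exact: measurableT_comp.
have : mu.-integrable B (EFin \o f).
  apply: le_integrable (integrable_cst_fin M mB B_fin) => //.
    exact/measurable_EFinP/measurable_funTS.
  move=> x _ /=; rewrite lee_fin /f (ger0_norm M0) ger0_norm ?ge_min ?lexx ?orbT//.
  by rewrite le_min normr_ge0.
move=> /integrableP[_]; apply: le_lt_trans.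
apply: ge0_le_integral => //.
- by move=> x _; rewrite lee_fin le_min normr_ge0.
- exact/measurable_EFinP/measurable_funTS.
- by apply: measurableT_comp => //; exact/measurable_EFinP/measurable_funTS.
- by move=> x _; rewrite lee_fin ler_norm.
Qed.

End LpIntegrability.

Section StressGrowth.
Context {R : realType}.
Variables (r lambda : R).
Hypotheses (r_gt1 : 1 < r) (lambda_gt0 : 0 < lambda).

(** Makes the stress locally integrable for a velocity gradient in L^r. Here |t| is at most a
    multiple of w^(1/2), so the stress is at most a multiple of w^(r/2-1/2), hence of w^(r/2) since
    w >= 1; the cruder exponent is enough. *)
Lemma carreau_stress_growth (s : R * R) (t : R) : `|t| <= enorm s ->
  `|carreau_visc lambda r s * t| <=
  Num.sqrt (2 / lambda) * 3 `^ (r / 2) *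
    (1 + (lambda / 2) `^ (r / 2) * (`|s.1| `^ r + `|s.2| `^ r)).
Proof.
move=> ts; set w := 1 + lambda / 2 * enorm s ^+ 2.
have l2 : 0 < lambda / 2 by rewrite divr_gt0.
have w1 : 1 <= w by rewrite lerDl mulr_ge0 ?sqr_ge0 ?(ltW l2).
have w0 : 0 < w by exact: lt_le_trans w1.
have c0 : 0 <= Num.sqrt (2 / lambda) by exact: sqrtr_ge0.
have tw : `|t| <= Num.sqrt (2 / lambda) * w `^ (2^-1).
  rewrite powR12_sqrt ?(ltW w0)// -sqrtrM ?divr_ge0 ?(ltW lambda_gt0)//.
  rewrite -sqrtr_sqr ler_wsqrtr//.
  apply: (@le_trans _ _ (enorm s ^+ 2)).
    by rewrite -real_normK ?num_real// lerXn2r ?nnegrE ?enorm_ge0.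
  rewrite (_ : 2 / lambda * w = 2 / lambda + enorm s ^+ 2).
    by rewrite lerDr divr_ge0 ?(ltW lambda_gt0).
  by rewrite /w; field; rewrite gt_eqF.
have step1 : `|carreau_visc lambda r s * t| <= Num.sqrt (2 / lambda) * w `^ (r / 2).
  rewrite normrM (gtr0_norm (carreau_visc_gt0 _ lambda_gt0 _)).
  apply: (@le_trans _ _ (w `^ (r / 2 - 1) * (Num.sqrt (2 / lambda) * w `^ (2^-1)))).
    by rewrite ler_wpM2l// powR_ge0.
  rewrite mulrCA ler_wpM2l// -powRD; last by rewrite (gt_eqF w0) implybT.
  by apply: ler_powR => //; lra.
apply: (le_trans step1); rewrite -mulrA ler_wpM2l//.
pose a := lambda / 2 * s.1 ^+ 2; pose b := lambda / 2 * s.2 ^+ 2.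
have a0 : 0 <= a by rewrite mulr_ge0 ?sqr_ge0 ?(ltW l2).
have b0 : 0 <= b by rewrite mulr_ge0 ?sqr_ge0 ?(ltW l2).
(* w is the sum of the three terms 1, a and b, hence the factor 3; the power of the maximum is then
   at most the sum of the powers. *)
pose M := Num.max 1 (Num.max a b).
have wM : w <= 3 * M.
  have h1 : 1 <= M by rewrite le_max lexx.
  have h2 : a <= M by rewrite !le_max lexx orbT.
  have h3 : b <= M by rewrite !le_max lexx !orbT.
  have -> : w = 1 + a + b by rewrite /w enorm_sqr /dot /a /b; ring.
  by lra.
have M0 : 0 <= M by rewrite le_max ler01.
have r2 : 0 <= r / 2 by rewrite divr_ge0// (le_trans ler01)// ltW.
apply: (@le_trans _ _ ((3 * M) `^ (r / 2))).
  by apply: ge0_ler_powR => //; rewrite nnegrE ?(ltW w0)// mulr_ge0.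
rewrite [leLHS]powRM// ler_wpM2l ?powR_ge0// mulrDr.
have pE (x : R) : (lambda / 2 * x ^+ 2) `^ (r / 2) = (lambda / 2) `^ (r / 2) * `|x| `^ r.
  rewrite powRM ?sqr_ge0 ?(ltW l2)//; congr (_ * _).
  rewrite -real_normK ?num_real// -powR_mulrn// -powRrM; congr (_ `^ _).
  by field.
rewrite -!pE -/a -/b /M; have A := powR_ge0 a (r / 2); have B := powR_ge0 b (r / 2).
case: (leP a b) => ab.
  case: (leP 1 b) => h; last by rewrite powR1 lerDl addr_ge0.
  by rewrite addrA lerDr addr_ge0.
case: (leP 1 a) => h; last by rewrite powR1 lerDl addr_ge0.
by rewrite addrCA lerDl addr_ge0.
Qed.

Lemma norm_fst_le_enorm (s : R * R) : `|s.1| <= enorm s.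
Proof.
rewrite -sqrtr_sqr ler_wsqrtr// /dot -expr2 lerDl -expr2 sqr_ge0 //.
Qed.

Lemma norm_snd_le_enorm (s : R * R) : `|s.2| <= enorm s.
Proof.
rewrite -sqrtr_sqr ler_wsqrtr// /dot -[s.2 * _]expr2 lerDr -expr2 sqr_ge0 //.
Qed.

End StressGrowth.

Section Boxes.
Context {R : realType}.

Lemma leb2_cbox2_fin (a b : R * R) : (leb2 (cbox2 a b) < +oo)%E.
Proof.
rewrite /leb2 /cbox2 product_measure1E; [|exact: measurable_itv|exact: measurable_itv].
rewrite /= !lebesgue_measure_itv/=.
by do 2 case: ifP => _; rewrite ?mul0e ?mule0// -!EFinB -EFinM ltry.
Qed.

Lemma leb3_cbox_fin (a b : R * R * R) : (leb3 (cbox a b) < +oo)%E.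
Proof.
rewrite /leb3 /cbox product_measure1E; [|exact: measurable_cbox2|exact: measurable_itv].
rewrite /= lebesgue_measure_itv/=.
have := leb2_cbox2_fin a.1 b.1.
rewrite /cbox2 => H.
case: ifP => _; last by rewrite mule0.
rewrite -EFinB; move: H; set l := leb2 _.
have l0 : (0 <= l)%E by exact: measure_ge0.
by case: l l0 => // x _ _; rewrite -EFinM ltry.
Qed.

End Boxes.

Section Assembly.
Context {R : realType}.
Local Notation mu := (@lebesgue_measure R).
Local Notation T3 := (measurableTypeR R * measurableTypeR R * measurableTypeR R)%type.

Lemma stress_integrable (r lambda : R) (d1 d2 d : T3 -> R) (B : set T3) :
  1 < r -> 0 < lambda ->
  measurable_fun setT d1 -> measurable_fun setT d2 -> measurable_fun setT d ->
  (forall y, `|d y| <= enorm (d1 y, d2 y)) ->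
  (@leb3 R).-integrable setT (EFin \o (fun y => `|d1 y| `^ r)) ->
  (@leb3 R).-integrable setT (EFin \o (fun y => `|d2 y| `^ r)) ->
  measurable B -> (leb3 B < +oo)%E ->
  (@leb3 R).-integrable B (EFin \o (fun y => carreau_visc lambda r (d1 y, d2 y) * d y)).
Proof.
move=> r1 l0 m1 m2 md dd i1 i2 mB B_fin.
pose C := Num.sqrt (2 / lambda) * 3 `^ (r / 2).
pose bound y := C * (1 + (lambda / 2) `^ (r / 2) * (`|d1 y| `^ r + `|d2 y| `^ r)).
have i12 : (@leb3 R).-integrable B (EFin \o
    (fun y => (lambda / 2) `^ (r / 2) * (`|d1 y| `^ r + `|d2 y| `^ r))).
  apply: integrableS measurableT mB (@subsetT _ _) _.
  exact/integrable_cst_mulr/integrable_add.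
have ib : (@leb3 R).-integrable B (EFin \o bound).
  exact: (integrableZl mB C (integrableD mB (integrable_cst_fin 1 mB B_fin) i12)).
apply: le_integrable ib => //.
  apply/measurable_EFinP/measurable_funTS/measurable_funM => //.
  rewrite (_ : (fun y => _) = (fun y => (1 + lambda / 2 *
      (d1 y * d1 y + d2 y * d2 y)) `^ (r / 2 - 1))); last first.
    by apply/funext => y; rewrite /carreau_visc enorm_sqr.
  apply: (measurableT_comp (measurable_powR _)).
  apply: measurable_funD => //; apply: measurable_funM => //.
  by apply: measurable_funD; exact: measurable_funM.
move=> y _ /=; rewrite lee_fin; apply: le_trans (ler_norm _).
exact: (carreau_stress_growth r1 l0 (dd y)).
Qed.

(** Fubini makes |w|^q integrable on almost every line, and on the bounded slice |w| is at most the
    indicator of [0, h x] plus |w|^q. *)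
Lemma slice_integrable (omega : set (R * R)) (h : R * R -> R) (w : R * R * R -> R) (q : R) :
  1 <= q -> Lp_on (@leb3 R) (Omega omega h) q%:E w ->
  {ae @leb2 R, forall x, omega x ->
    mu.-integrable setT (EFin \o (fun t => (w \_ (Omega omega h)) (x, t)))}.
Proof.
move=> q1 Lw; set W := w \_ _.
have mW : measurable_fun setT (W : T3 -> R) by exact: Lp_on_measurable Lw.
have := ae_integrable1 (Lp_on_powR_integrable q1 Lw).
apply: aeS => x ix ox.
have := integrableD measurableT ix (integrable_itv 0 (h x)).
apply: le_integrable => //.
  by apply/measurable_EFinP; apply: (measurableT_comp mW); exact: pair1_measurable.
move=> t _ /=; rewrite lee_fin [leRHS]ger0_norm; last first.
  by rewrite addr_ge0 ?powR_ge0.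
have [xt|xt] := pselect (Omega omega h (x, t)).
  rewrite indicE mem_set; first by rewrite addrC norm_le_powR.
  by case: xt => _ /andP[/= t0 th]; rewrite /= in_itv/= !ltW.
by rewrite {1}/W /patch memNset// normr0 addr_ge0 ?powR_ge0.
Qed.

Lemma ae_all_itv (a b : R) (P : R -> Prop) : {ae mu, forall z, z \in `]a, b[ -> P z} ->
  {ae mu, forall z, z \in `[a, b] -> P z}.
Proof.
move=> H; have H' := aeS2 (fun x p q => conj p q) (ae_neq a) (ae_neq b).
apply: aeS2 H H' => z Pz [za zb]; rewrite in_itv/= => /andP[az zb'].
by apply: Pz; rewrite in_itv/= lt_neqAle eq_sym za az lt_neqAle zb zb'.
Qed.

End Assembly.

(** * The Reynolds velocity *)

Section ReynoldsVelocity.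
Context {R : realType}.
Local Notation mu := (@lebesgue_measure R).
Local Notation T3 := (measurableTypeR R * measurableTypeR R * measurableTypeR R)%type.
Variables (omega : set (R * R)) (h : R * R -> R) (hmin hmax : R).
Hypotheses (omega_open : open omega)
  (h_cont : forall x, omega x -> {for x, continuous h}) (hmin_gt0 : 0 < hmin)
  (h_bnd : forall x, omega x -> hmin <= h x <= hmax).

Let Om := Omega omega h.

Let Om_open : open Om. Proof. exact: open_Omega. Qed.

Let h_gt0 x : omega x -> 0 < h x.
Proof. by move=> /h_bnd /andP[hx _]; exact: lt_le_trans hx. Qed.

Let patch_out (w : R * R * R -> R) x z : z \notin `]0, h x[ -> (w \_ Om) (x, z) = 0.
Proof.
move=> zh; rewrite /patch memNset// => -[_ zh']; move/negP: zh; apply.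
by rewrite in_itv.
Qed.

Let patch_in (w : R * R * R -> R) x z : omega x -> z \in `]0, h x[ ->
  (w \_ Om) (x, z) = w (x, z).
Proof.
by move=> ox zh; rewrite /patch mem_set//; split => //; move: zh; rewrite in_itv.
Qed.

Lemma ae_component_moments (r : R) (w dw : R * R * R -> R) : 1 <= r ->
  V3 Om r w dw -> has_traces omega h w dw (cst 0) (cst 0) ->
  {ae @leb2 R, forall x, omega x ->
    [/\ mu.-integrable setT (EFin \o (fun z => (dw \_ Om) (x, z))),
        \int[mu]_z (dw \_ Om) (x, z) = 0
      & \int[mu]_(z in `[0, h x]) w (x, z) =
          - \int[mu]_z (z * (dw \_ Om) (x, z))]}.
Proof.
move=> r1 [Lw Ldw _] tr.
(* The maximum with 0 covers an empty [omega], for which the bounds on h say nothing about the sign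
   of [hmax]. *)
have H0 : 0 <= Num.max 0 hmax by rewrite le_max lexx.
have hH x : omega x -> h x <= Num.max 0 hmax.
  by move=> /h_bnd /andP[_ hx]; rewrite le_max hx orbT.
have intB (g : R * R * R -> R) : Lp_on (@leb3 R) Om r%:E g -> forall a b : R * R,
    lt2 a b -> cbox2 a b `<=` omega ->
    (@leb3 R).-integrable (cbox (a, - 2) (b, Num.max 0 hmax + 2)) (EFin \o (g \_ Om)).
  move=> Lg a b _ _; apply: (Lp_on_integrable r1 Lg); first exact: measurable_cbox.
  exact: leb3_cbox_fin.
have A1 := trace_moments omega_open H0 hH (intB w Lw) (intB dw Ldw) tr.
have A2 := aeS2 (fun x p q => conj p q) (slice_integrable r1 Lw) (slice_integrable r1 Ldw).
apply: aeS2 A1 A2 => x A1 [A2 A3] ox.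
have [I1 I2] := A1 ox; have iW := A2 ox; have iDW := A3 ox; split => //.
have iM := integrable_moment (h_gt0 ox) iDW (patch_out dw (x := x)).
have I3 : \int[mu]_z ((w \_ Om) (x, z) + z * (dw \_ Om) (x, z)) =
    \int[mu]_z (w \_ Om) (x, z) + \int[mu]_z (z * (dw \_ Om) (x, z)).
  exact: (RintegralD measurableT iW iM).
transitivity (\int[mu]_z (w \_ Om) (x, z)); last first.
  by apply/eqP; rewrite -addr_eq0; apply/eqP; rewrite -[RHS]I2 -I3.
transitivity (\int[mu]_(z in `[0, h x]) (w \_ Om) (x, z)).
  apply: Rintegral_ae_eq; apply: (@ae_all_itv R 0 (h x)); apply: aeW => z zh.
  by rewrite patch_in.
apply: Rintegral_supp => z zh; apply: patch_out; apply/negP => zh'; apply: zh.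
exact: subset_itv_oo_cc.
Qed.

Variables (r r' eta0 lambda : R) (f : R * R -> R * R) (u du : R * R * R -> R * R * R)
  (p : R * R -> R) (gp : R * R -> R * R).
Hypotheses (r_gt1 : 1 < r) (r_neq2 : r != 2) (rr' : r^-1 + r'^-1 = 1)
  (eta0_gt0 : 0 < eta0) (lambda_gt0 : 0 < lambda)
  (f1_Linf : Lp_on leb2 omega +oo%E (fun x => (f x).1))
  (f2_Linf : Lp_on leb2 omega +oo%E (fun x => (f x).2))
  (u1_V : V3 Om r (fun y => (u y).1.1) (fun y => (du y).1.1))
  (u2_V : V3 Om r (fun y => (u y).1.2) (fun y => (du y).1.2))
  (gp1_L : Lp_on leb2 omega r'%:E (fun x => (gp x).1))
  (gp2_L : Lp_on leb2 omega r'%:E (fun x => (gp x).2))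
  (u3_eq0 : {ae leb3, forall y, Om y -> (u y).2 = 0})
  (sol : reduced_carreau_stokes omega h r eta0 lambda f u du p gp).

Let r'_ge1 : 1 <= r'.
Proof.
have r0 : 0 < r by exact: lt_trans r_gt1.
have ri : 0 < r^-1 by rewrite invr_gt0.
have ri1 : r^-1 < 1 by rewrite invf_lt1.
have r'i : r'^-1 = 1 - r^-1 by apply/eqP; rewrite eq_sym subr_eq addrC rr'.
have r'i0 : 0 < r'^-1 by rewrite r'i subr_gt0.
rewrite -[r']invrK invf_ge1// r'i gerBl; exact: ltW.
Qed.

Let force_integrable (fi gi : R * R -> R) a b : Lp_on leb2 omega +oo%E fi ->
  Lp_on leb2 omega r'%:E gi -> cbox2 a b `<=` omega ->
  (@leb2 R).-integrable (cbox2 a b) (EFin \o (fun x => 2 / eta0 * (fi x - gi x))).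
Proof.
move=> Lf Lg abo; have mB := measurable_cbox2 a b; have B_fin := leb2_cbox2_fin a b.
have H := integrableB mB (Linf_on_integrable Lf mB B_fin)
  (Lp_on_integrable r'_ge1 Lg mB B_fin).
have := integrableZl mB (2 / eta0) H.
apply: eq_integrable => // x; rewrite inE => /abo ox /=.
by rewrite /patch mem_set.
Qed.

Let visc y := carreau_visc lambda r (du y).1.

(** The projection [i] selects a component of the stress, so that one growth estimate serves both
    scalar momentum equations. The minus sign is that of the weak equation. *)
Let stress_box_integrable (i : R * R -> R) : i = fst \/ i = snd -> forall a b, lt3 a b ->
  cbox a b `<=` Om ->
  (@leb3 R).-integrable (cbox a b) (EFin \o (fun y => - (visc y * i (du y).1))).
Proof.
have [_ L1 _] := u1_V; have [_ L2 _] := u2_V; have r1 := ltW r_gt1.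
move=> ii a b _ abO.
pose d1 := (fun y => (du y).1.1) \_ Om; pose d2 := (fun y => (du y).1.2) \_ Om.
pose d (y : T3) := i (d1 y, d2 y).
have m1 := Lp_on_measurable L1; have m2 := Lp_on_measurable L2.
have md : measurable_fun setT d by rewrite /d; case: ii => ->.
have dd y : `|d y| <= enorm (d1 y, d2 y).
  by rewrite /d; case: ii => ->;
    [exact: (norm_fst_le_enorm (_, _))|exact: (norm_snd_le_enorm (_, _))].
have mB := measurable_cbox a b.
have H := stress_integrable r_gt1 lambda_gt0 m1 m2 md dd
  (Lp_on_powR_integrable r1 L1) (Lp_on_powR_integrable r1 L2) mB (leb3_cbox_fin a b).
have := integrableN H.
apply: eq_integrable => // y; rewrite inE => /abO Oy /=.
by rewrite /visc /d /d1 /d2 /patch !mem_set// -surjective_pairing.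
Qed.

Lemma ae_reynolds : {ae @leb2 R, forall x, omega x ->
  (reynolds h u x).1 = (2 * mobility r eta0 lambda (h x) (f x - gp x)) *: (f x - gp x) /\
  (reynolds h u x).2 = 0}.
Proof.
have r1 := ltW r_gt1.
have h_ge x : omega x -> hmin <= h x by move=> /h_bnd /andP[].
have [[wd1 wd2] _ _ [tr1 tr2]] := sol.
have [c1 S1] := weak_d3_affine Om_open hmin_gt0 h_ge
  (stress_box_integrable (or_introl erefl))
  (fun a b _ abo => force_integrable f1_Linf gp1_L abo) wd1.
have [c2 S2] := weak_d3_affine Om_open hmin_gt0 h_ge
  (stress_box_integrable (or_intror erefl))
  (fun a b _ abo => force_integrable f2_Linf gp2_L abo) wd2.
have S := aeS2 (fun x p q => conj p q) (aeS2 (fun x p q => conj p q) S1 S2) u3_eq0.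
have {}S := ae_xsection S.
have M1 := ae_component_moments r1 u1_V tr1.
have M2 := ae_component_moments r1 u2_V tr2.
apply: aeS2 (aeS2 (fun x p q => conj p q) M1 M2) S => x [A1 A2] S ox.
have [iD1 D1_0 W1] := A1 ox; have [iD2 D2_0 W2] := A2 ox.
have hx0 := h_gt0 ox; set g := f x - gp x.
(* The affine form was obtained for minus the stress, with slope (2/eta0) g; hence the constant
   (-c1, -c2) and the negative slope. *)
have stressE : {ae mu, forall z, z \in `]0, h x[ ->
    carreau_visc lambda r (((fun y => (du y).1.1) \_ Om) (x, z),
                           ((fun y => (du y).1.2) \_ Om) (x, z))
      *: (((fun y => (du y).1.1) \_ Om) (x, z), ((fun y => (du y).1.2) \_ Om) (x, z))
    = (- c1 x, - c2 x) - (2 / eta0 * z) *: g}.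
  apply: aeS S => z [[s1 s2] _] zh.
  rewrite !patch_in// -surjective_pairing.
  have Oz : Om (x, z) by split => //; move: zh; rewrite in_itv.
  move: (s1 Oz) (s2 Oz); rewrite /visc /= => e1 e2.
  apply: injective_projections => /=.
    transitivity (- - (carreau_visc lambda r (du (x, z)).1 * (du (x, z)).1.1)).
      by rewrite opprK.
    rewrite e1; transitivity (- c1 x - (2 / eta0 * z) * g.1) => //.
    rewrite /g /=; ring.
  transitivity (- - (carreau_visc lambda r (du (x, z)).1 * (du (x, z)).1.2)).
    by rewrite opprK.
  rewrite e2; transitivity (- c2 x - (2 / eta0 * z) * g.2) => //.
  rewrite /g /=; ring.
have [N1 N2] := slice_moments r_gt1 r_neq2 eta0_gt0 lambda_gt0 hx0 iD1 iD2
  (patch_out _ (x := x)) (patch_out _ (x := x)) D1_0 D2_0 stressE.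
split.
  apply: injective_projections => /=.
    by rewrite W1 N1 opprK.
  by rewrite W2 N2 opprK.
rewrite /=; transitivity (\int[mu]_(z in `[0, h x]) (0 : R)).
  apply: Rintegral_ae_eq; apply: (@ae_all_itv R 0 (h x)).
  apply: aeS S => z [_ s3] zh; apply: s3; split => //.
by rewrite /Rintegral integral0.
Qed.

End ReynoldsVelocity.

(** * The Reynolds velocity and the limit law for the pressure *)

Unset Implicit Arguments.

Theorem corollary6p5 (R : realType)
    (omega : set (R * R)) (h : R * R -> R) (hmin hmax : R)
    (r r' eta0 lambda : R) (f : R * R -> R * R)
    (u du : R * R * R -> R * R * R) (p : R * R -> R) (gp : R * R -> R * R)
    (omega_open : open omega) (omega_conn : connected omega)
    (omega_smooth : smooth_boundary omega)
    (hC1 : Ck_on omega 1 h) (hmin_gt0 : 0 < hmin)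
    (h_bnd : forall x, omega x -> hmin <= h x <= hmax)
    (r_gt1 : 1 < r) (r_neq2 : r != 2) (rr' : r^-1 + r'^-1 = 1)
    (eta0_gt0 : 0 < eta0) (lambda_gt0 : 0 < lambda)
    (f1_Linf : Lp_on leb2 omega +oo%E (fun x => (f x).1))
    (f2_Linf : Lp_on leb2 omega +oo%E (fun x => (f x).2))
    (u1_V : V3 (Omega omega h) r (fun y => (u y).1.1) (fun y => (du y).1.1))
    (u2_V : V3 (Omega omega h) r (fun y => (u y).1.2) (fun y => (du y).1.2))
    (u3_V : V3 (Omega omega h) r (fun y => (u y).2) (fun y => (du y).2))
    (p_L : Lp_on leb2 omega r'%:E p)
    (p_mean0 : \int[leb2]_(x in omega) p x = 0)
    (p_grad : weak_grad omega p gp)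
    (gp1_L : Lp_on leb2 omega r'%:E (fun x => (gp x).1))
    (gp2_L : Lp_on leb2 omega r'%:E (fun x => (gp x).2))
    (u3_eq0 : {ae leb3, forall y, Omega omega h y -> (u y).2 = 0})
    (sol : reduced_carreau_stokes omega h r eta0 lambda f u du p gp) :
  let g x := f x - gp x in
  let W x := mobility r eta0 lambda (h x) (g x) *: g x in
  [/\ forall tau, 0 <= tau -> exists! zeta, carreau_rel r eta0 lambda tau zeta,
      {ae leb2, forall x, omega x ->
         (reynolds h u x).1 = (2 * mobility r eta0 lambda (h x) (g x)) *: g x /\
         (reynolds h u x).2 = 0},
      weak_div omega W (cst 0)
    & zero_normal_trace omega W (cst 0)].
Proof.
move=> g W; have [_ div0 trace0 _] := sol.
have aeV := ae_reynolds omega_open (fun x ox => hC1.1 x ox) hmin_gt0 h_bnd r_gt1 r_neq2 rr'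
  eta0_gt0 lambda_gt0 f1_Linf f2_Linf u1_V u2_V gp1_L gp2_L u3_eq0 sol.
(* [W] is half the horizontal Reynolds velocity almost everywhere on [omega], so each weak identity
   for the latter is twice the one for [W]. Both the replacement and the extraction of the factor 2
   are done with integral rules valid for arbitrary functions. *)
have pairing (theta : R * R -> R) :
    {ae leb2, forall x, omega x ->
      dot (reynolds h u x).1 (grad theta x) = 2 * dot (W x) (grad theta x)}.
  apply: aeS aeV => x Vx ox; have [-> _] := Vx ox.
  by rewrite /W -scalerA /dot /= /GRing.scale/=; ring.
split => //.
- exact: carreau_rel_unique.
- move=> theta tth.
  have := div0 theta tth; rewrite (Rintegral_ae_eq (pairing theta)) RintegralZl_any//.
  have -> : \int[leb2]_(x in omega) (cst 0 x * theta x) = 0.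
    transitivity (\int[leb2]_(x in omega) (0 : R)); last by rewrite /Rintegral integral0.
    by congr Rintegral; apply/funext => x; rewrite mul0r.
  by rewrite oppr0 => /eqP; rewrite mulf_eq0 pnatr_eq0 => /eqP.
- move=> theta tth; have := trace0 theta tth.
  have pairing0 : {ae leb2, forall x, omega x ->
      dot (reynolds h u x).1 (grad theta x) + cst 0 x * theta x =
      2 * (dot (W x) (grad theta x) + cst 0 x * theta x)}.
    by apply: aeS (pairing theta) => x Vx ox; rewrite (Vx ox) !mul0r !addr0.
  rewrite (Rintegral_ae_eq pairing0) RintegralZl_any//.
  by move=> /eqP; rewrite mulf_eq0 pnatr_eq0 => /eqP.
Qed.
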